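(* Let $D>0$, $A\in\mathbb R$, $T>0$, let $u_0$ be a probability density on $\mathbb R$ with finite second moment, and let $u$ solve the advection-diffusion equation $$u_t+A\,u_x=D\,u_{xx}\quad\text{on }\mathbb R\times(0,T],\qquad u(\cdot,0)=u_0 .$$ Let $r>0$ be a reference probability density on $\mathbb R$, and let $\widehat u$ be the CDT of $u$ with respect to $r$. For $0\le t_0<T$ let $\widehat{\mathcal M}_{[t_0,T]}:=\{\widehat u(\cdot,t):t\in[t_0,T]\}$. Then, for every $t_0\in(0,T)$, $$d_2\big(\widehat{\mathcal M}_{[t_0,T]};L^2(dr)\big)\le D^2\,\frac{(T-t_0)^2}{2}\,C(u(\cdot,t_0)).$$ If, additionally, $u_0\in C^3(\mathbb R)$, $u_0>0$, and $u_0^{(j)}\in L^\infty(\mathbb R)\cap L^1(\mathbb R)$ for $j=0,1,2,3$, then the same bound also holds for $t_0=0$ (with $u(\cdot,0)=u_0$).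
   Context: The solution is $u(x,t)=(G_{Dt}*u_0)(x-At)$ for $t>0$ and $u(\cdot,0)=u_0$, where $G_s(x)=\frac{1}{\sqrt{4\pi s}}e^{-x^2/(4s)}$ is the heat kernel. The constant: for a positive, three times differentiable probability density $w$ on $\mathbb R$, $C(w)\in[0,\infty]$ is defined by $$C(w)^2:=3\int_{\mathbb R}\left|\frac{w'''}{w}\right|^2w\,dx+12\left(\int_{\mathbb R}\left|\frac{w'}{w}\right|^4w\,dx\right)^{1/2}\left(\int_{\mathbb R}\left|\frac{w''}{w}\right|^4w\,dx\right)^{1/2}+3\int_{\mathbb R}\left|\frac{w'}{w}\right|^6w\,dx$$ (the bound is vacuous if $C(w)=\infty$). CDT: for a probability density $w$ on $\mathbb R$ with finite second moment, $F_w(x)=\int_{-\infty}^xw(s)\,ds$, $F_w^\dagger(p)=\inf\{x\in\mathbb R:F_w(x)\ge p\}$ for $p\in(0,1)$, and the cumulative distribution transform (CDT) of $w$ with respect to $r$ is $\widehat w(\xi)=F_w^\dagger(F_r(\xi))$. For a time-dependent $u$, $\widehat u(\cdot,t)$ is the CDT of $u(\cdot,t)$. $L^2(dr)$ is the $L^2$ space on $\mathbb R$ with respect to the measure $r(\xi)\,d\xi$. Kolmogorov $n$-width: for a subset $\mathcal S$ of a Hilbert space $\mathcal H$, $d_n(\mathcal S;\mathcal H)=\inf_{V\subset\mathcal H,\ \dim V\le n}\ \sup_{w\in\mathcal S}\ \inf_{h\in V}\|w-h\|_{\mathcal H}$, the infimum being over linear subspaces $V$. *)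

(* Defs.v *)
#[export] Set Warnings "-notation-overridden,-ambiguous-paths,-notation-incompatible-prefix,-redundant-canonical-projection".
From HB Require Import structures.
From mathcomp Require Export all_boot all_order all_algebra.
From mathcomp Require Export all_classical all_reals all_analysis.
From mathcomp Require Export measurable_realfun ess_sup_inf.

#[export] Set Implicit Arguments.
#[export] Unset Strict Implicit.
#[export] Unset Printing Implicit Defensive.

Export Order.TTheory GRing.Theory Num.Theory.
Export numFieldNormedType.Exports.

Local Open Scope classical_set_scope.
Local Open Scope ring_scope.

Section ProbabilityDensity.
Context (R : realType).
Local Notation leb := (@lebesgue_measure R).

Definition prob_density (w : R -> R) : Prop :=
  [/\ measurable_fun [set: R] w,
      forall x, 0 <= w x &
      (\int[leb]_x (w x)%:E = 1)%E].

Definition finite_second_moment (w : R -> R) : Prop :=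
  (\int[leb]_x (x ^+ 2 * w x)%:E < +oo)%E.

(* The proof argument only serves to attach the measure structure below. *)
Definition density_measure (w : R -> R) (hw : prob_density w)
    : set (measurableTypeR R) -> \bar R :=
  fun U => (\int[leb]_(x in U) (w x)%:E)%E.

Section DensityMeasureInstance.
Variables (w : R -> R) (hw : prob_density w).

Let density_measure0 : density_measure hw set0 = 0%E.
Proof. by rewrite /density_measure integral_set0. Qed.

Let density_measure_ge0 U : (0 <= density_measure hw U)%E.
Proof.
by have [_ w0 _] := hw; apply: integral_ge0 => x _; rewrite lee_fin.
Qed.

Let density_measure_sigma_additive : semi_sigma_additive (density_measure hw).
Proof.
have [mw w0 _] := hw.
move=> /= F mF tF mUF; rewrite /density_measure; apply: cvg_toP.
  apply: ereal_nondecreasing_is_cvgn => m n mn.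
  apply: lee_sum_nneg_natr => // k _ _.
  by apply: integral_ge0 => /= x _; rewrite lee_fin.
rewrite ge0_integral_bigcup//=.
- by apply: measurable_funTS; exact: measurableT_comp.
- by move=> x _; rewrite lee_fin.
Qed.

HB.instance Definition _ := isMeasure.Build _ _ _ (density_measure hw)
  density_measure0 density_measure_ge0 density_measure_sigma_additive.

Let density_measure_setT : density_measure hw [set: _] = 1%E.
Proof. by have [_ _] := hw. Qed.

HB.instance Definition _ := @Measure_isProbability.Build _ _ R
  (density_measure hw) density_measure_setT.

End DensityMeasureInstance.

End ProbabilityDensity.

Section AdvectionDiffusion.
Context (R : realType).
Local Notation leb := (@lebesgue_measure R).

Definition heat_kernel (s x : R) : R :=
  (Num.sqrt (4 * pi * s))^-1 * expR (- x ^+ 2 / (4 * s)).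

Definition convolution (f g : R -> R) (x : R) : R :=
  \int[leb]_y (f (x - y) * g y).

(* The solution of u_t + A u_x = D u_xx with initial datum u0: the function
   u(., t) is [advdiff_solution D A u0 t]. *)
Definition advdiff_solution (D A : R) (u0 : R -> R) (t : R) : R -> R :=
  if 0 < t then fun x => convolution (heat_kernel (D * t)) u0 (x - A * t)
  else u0.

(* The constant C(w), only meaningful for a positive, three times
   differentiable density w; it may be +oo. *)
Definition C_const (w : R -> R) : \bar R :=
  sqrte
   (3%:E * (\int[leb]_x (`|derive1n 3 w x / w x| ^+ 2 * w x)%:E)
    + 12%:E * sqrte (\int[leb]_x (`|derive1n 1 w x / w x| ^+ 4 * w x)%:E)
            * sqrte (\int[leb]_x (`|derive1n 2 w x / w x| ^+ 4 * w x)%:E)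
    + 3%:E * (\int[leb]_x (`|derive1n 1 w x / w x| ^+ 6 * w x)%:E))%E.

Definition C3 (f : R -> R) : Prop :=
  (forall j, (j < 3)%N -> forall x, derivable (derive1n j f) x 1)
  /\ continuous (derive1n 3 f).

End AdvectionDiffusion.

Section CumulativeDistributionTransform.
Context (R : realType).
Local Notation leb := (@lebesgue_measure R).

Definition cumulative (w : R -> R) (x : R) : R :=
  \int[leb]_(s in `]-oo, x]) w s.

Definition quantile (w : R -> R) (p : R) : R :=
  inf [set x | p <= cumulative w x].

Definition cdt (r w : R -> R) (xi : R) : R := quantile w (cumulative r xi).

End CumulativeDistributionTransform.

Section KolmogorovWidth.
Local Open Scope ereal_scope.

(* A subspace has dimension at most n iff it is spanned by n vectors,
   which are not required to be independent. *)
Definition subspace_of_dim_le (R : realType) (E : lmodType R) (n : nat)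
    (V : set E) : Prop :=
  exists b : 'I_n -> E,
    V = range (fun c : 'I_n -> R => (\sum_(i < n) c i *: b i)%R).

(* The n-width of S in the space H, where H is given as a subspace of an
   ambient vector space E and N : E -> \bar R restricts to the (semi)norm
   of H. *)
Definition kolmogorov_width (R : realType) (E : lmodType R) (H : set E)
    (N : E -> \bar R) (n : nat) (S : set E) : \bar R :=
  ereal_inf
    [set ereal_sup
       [set ereal_inf [set N (w - h)%R | h in V] | w in S]
    | V in [set V : set E | V `<=` H /\ subspace_of_dim_le n V]].

(* The n-width in L^2(mu), computed on representatives: the elements of
   L^2(mu) are measurable functions with finite L^2 seminorm. *)
Definition L2_width d (T : measurableType d) (R : realType)
    (mu : {measure set T -> \bar R}) (n : nat) (S : set (T -> R)) : \bar R :=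
  kolmogorov_width [set` Lfun mu 2%:E]
    (fun f : T -> R => 'N[mu]_2%:E[EFin \o f]) n S.

End KolmogorovWidth.

(* Main.v *)
Require Import Defs.
From mathcomp Require Import ring lra.

Local Open Scope classical_set_scope.
Local Open Scope ring_scope.

(* In the time variable [tau = D t], and up to the translation by [A t], the
   solution is [h(tau) = G_tau * w]. Its quantile curves [Z(tau)] satisfy
   [Z' = - v(Z, tau)] with [v = h_x / h], hence [Z'' = - (v_xx + v v_x)(Z, tau)]
   and [v_xx + v v_x = h'''/h - 2 h' h''/h^2 + (h'/h)^3]. The CDT
   [xi -> Z(tau)] transports [r dxi] to [h(tau) dx], so the [L^2(dr)] norm of
   [Z''] is at most [C(h(tau))] by Cauchy-Schwarz, and [C(h(tau)) <= C(w)] by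
   Jensen's inequality for the perspectives [|a|^m / b^(m-1)]. The first order
   Taylor polynomial of the CDT at [t0] therefore spans a good 2-dimensional
   subspace. Writing [tau = s^2] and [h(s^2, x) = E w(x + s Z)] with [Z] Gaussian
   makes everything smooth up to [s = 0], so no limit [t0 -> 0] is needed; for
   [t0 > 0] the density [w = G_{D t0} * u0] is smooth and the semigroup property
   reduces the claim to the case of a smooth initial datum. *)

(** * Integration against a density *)

(** The Taylor remainder is never written as an integral. An integral over [s] inside the [L^2(dr)]
    norm would call for Minkowski's integral inequality and joint measurability of the curvature in
    [s] and [xi]. Riemann sums, a weighted Cauchy-Schwarz inequality and Fatou's lemma give the same
    bound from measurability at each fixed [s]. The constant is
    [int_0^S 2 s (S^2 - s^2) ds = S^4 / 2], that is [D^2 (t - t0)^2 / 2] when [S^2 = D (t - t0)].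
    The quantile curves are only given implicitly, by [F_s(Z(s)) = p], so their differentiability is
    proved by hand from the mean value theorem. Advection adds [A t] to the CDT; being affine in
    time, it is reproduced exactly by the Taylor polynomial. If [C] is infinite there is nothing to
    prove. If it is finite, it controls the Fisher information, which places the velocity of the CDT
    at [t0], hence the whole approximating subspace, in [L^2(dr)]. *)

Section Density.
Context (R : realType).
Local Notation leb := (@lebesgue_measure R).

Lemma density_dominates (w : R -> R) (hw : prob_density w) :
  density_measure hw `<< leb.
Proof.
apply/null_content_dominatesP => A mA A0.
apply: null_set_integral => //.
have [mw _ _] := hw.
by apply/measurable_EFinP; exact: measurable_funTS.
Qed.

Lemma ge0_integral_density (w : R -> R) (hw : prob_density w)
    (f : R -> \bar R) :
  measurable_fun setT f -> (forall x, 0 <= f x)%E ->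
  (\int[density_measure hw]_x f x = \int[leb]_x (f x * (w x)%:E))%E.
Proof.
move=> mf f0.
have dom := density_dominates hw; have [mw w0 w1] := hw.
have mwE : measurable_fun setT (EFin \o w) by exact/measurable_EFinP.
rewrite -(Radon_Nikodym_SigmaFinite.change_of_variables dom) //.
apply: ae_eq_integral => //.
- apply: emeasurable_funM => //.
  exact: measurable_int (Radon_Nikodym_SigmaFinite.f_integrable dom).
- exact: emeasurable_funM.
(* The Radon-Nikodym derivative agrees with [w] almost everywhere, since both have the same integral
   over every measurable set. *)
- apply: ae_eqe_mul2l; apply: integral_ae_eq => //.
  + exact: Radon_Nikodym_SigmaFinite.f_integrable.
  + by move=> E _ mE; rewrite -Radon_Nikodym_SigmaFinite.f_integral.
Qed.

Lemma integral_density (w : R -> R) (hw : prob_density w) (f : R -> \bar R) :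
  measurable_fun setT f ->
  (\int[density_measure hw]_x f x = \int[leb]_x (f x * (w x)%:E))%E.
Proof.
move=> mf; have [mw w0 w1] := hw.
(* As [w] is nonnegative, multiplying by it commutes with taking positive and negative parts. *)
have fM (g : R -> \bar R) x : maxe (g x * (w x)%:E)%E 0%E = (maxe (g x) 0 * (w x)%:E)%E.
  by rewrite maxe_pMl ?lee_fin// mul0e.
rewrite integralE [RHS]integralE.
rewrite (ge0_integral_density hw (measurable_funepos mf))//.
rewrite (ge0_integral_density hw (measurable_funeneg mf))//.
congr (_ - _)%E; apply: eq_integral => x _.
  by rewrite !funeposE fM.
by rewrite !funenegE -(fM (fun x => - f x)%E) mulNe.
Qed.

End Density.

Lemma integrable_dominated d (X : measurableType d) (R : realType)
    (mu : {measure set X -> \bar R}) (f g : X -> R) :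
  measurable_fun setT f -> (forall x, `|f x| <= g x) ->
  mu.-integrable setT (fun x => (g x)%:E) ->
  mu.-integrable setT (fun x => (f x)%:E).
Proof.
move=> mf fg; apply: le_integrable => //; first exact/measurable_EFinP.
by move=> x _ /=; rewrite lee_fin (le_trans (fg x))// ler_norm.
Qed.

Lemma bounded_integrable d (X : measurableType d) (R : realType)
    (P : probability X R) (f : X -> R) (B : R) :
  measurable_fun setT f -> (forall x, `|f x| <= B) ->
  P.-integrable setT (fun x => (f x)%:E).
Proof.
move=> mf fB; apply: integrable_dominated mf fB _.
exact: (@finite_measure_integrable_cst _ _ _ P).
Qed.

Section RealIntegrable.
Context d (X : measurableType d) (R : realType) (mu : {measure set X -> \bar R}).
Implicit Types f g : X -> R.

Lemma integrable_addR f g :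
  mu.-integrable setT (fun x => (f x)%:E) ->
  mu.-integrable setT (fun x => (g x)%:E) ->
  mu.-integrable setT (fun x => (f x + g x)%:E).
Proof. exact: (@integrableD _ _ _ mu _ measurableT (EFin \o f) (EFin \o g)). Qed.

Lemma integrable_subR f g :
  mu.-integrable setT (fun x => (f x)%:E) ->
  mu.-integrable setT (fun x => (g x)%:E) ->
  mu.-integrable setT (fun x => (f x - g x)%:E).
Proof. exact: (@integrableB _ _ _ mu _ measurableT (EFin \o f) (EFin \o g)). Qed.

Lemma integrable_scaleR f (c : R) :
  mu.-integrable setT (fun x => (f x)%:E) ->
  mu.-integrable setT (fun x => (c * f x)%:E).
Proof. exact: (@integrableZl _ _ _ mu _ measurableT c (EFin \o f)). Qed.

End RealIntegrable.

(** * Derivative rules and the heat kernel *)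

Section DerivativeRules.
Context (R : realType).
Implicit Types (f g : R -> R) (x a b : R).

(** These rules use pointwise functions and [*] in place of [*:], so that they nest as proof terms
    and the derivative is left to [ring] or [field]. *)
Lemma derive_id_rule x : is_derive x (1 : R) (fun t : R => t) 1.
Proof. exact: is_derive_id. Qed.

Lemma derive_cst_rule (c x : R) : is_derive x (1 : R) (fun _ : R => c) 0.
Proof. exact: is_derive_cst. Qed.

Lemma derive_add_rule f g x a b :
  is_derive x 1 f a -> is_derive x 1 g b ->
  is_derive x 1 (fun t => f t + g t) (a + b).
Proof. exact: is_deriveD. Qed.

Lemma derive_opp_rule f x a :
  is_derive x 1 f a -> is_derive x 1 (fun t => - f t) (- a).
Proof. exact: is_deriveN. Qed.

Lemma derive_mul_rule f g x a b :
  is_derive x 1 f a -> is_derive x 1 g b ->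
  is_derive x 1 (fun t => f t * g t) (a * g x + f x * b).
Proof.
move=> df dg; have := @is_deriveM _ _ f g x 1 a b df dg.
by rewrite -[_ *: b]/(_ * _) -[_ *: a]/(_ * _) addrC mulrC [in X in X + _]mulrC
  [X in _ + X]mulrC mulrC.
Qed.

Lemma derive_exp_rule f n x a :
  is_derive x 1 f a ->
  is_derive x 1 (fun t => f t ^+ n) (n%:R * f x ^+ n.-1 * a).
Proof. by move=> df; have := is_deriveX n df; rewrite exprfctE. Qed.

Lemma derive_inv_rule f x a : f x != 0 ->
  is_derive x 1 f a -> is_derive x 1 (fun t => (f t)^-1) (- a / f x ^+ 2).
Proof.
move=> fx0 df; have := @is_deriveV R f x a 1 fx0 df.
rewrite -[_ *: _]/(_ * _).
by rewrite !mulNr mulrC.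
Qed.

Lemma derive_comp_rule f g x a b :
  is_derive (g x) 1 f a -> is_derive x 1 g b ->
  is_derive x 1 (fun t => f (g t)) (a * b).
Proof. by move=> df dg; exact: is_derive1_comp. Qed.

End DerivativeRules.

Section AffineSubstitution.
Context (R : realType).
Local Notation leb := (@lebesgue_measure R).

Lemma ge0_integral_affine (f : R -> R) (a b : R) : 0 < a ->
  continuous f -> (forall x, 0 <= f x) ->
  (\int[leb]_x (f x)%:E = \int[leb]_x (a * f (a * x + b))%:E)%E.
Proof.
move=> a0 cf f0.
pose F : R -> R := fun x => a * x + b.
have dF (x : R) : is_derive x 1 F a.
  by rewrite /F; apply: is_derive_eq; rewrite -?[_ *: _]/(_ * _); ring.
have F'E : derive1 F = cst a.
  by apply/funext => x; rewrite derive1E; exact: derive_val.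
rewrite (@increasing_ge0_integration_by_substitutionT _ F)//.
- by apply: eq_integral => x _; rewrite F'E /= mulrC.
- by move=> x y xy; rewrite /F ltrD2r ltr_pM2l.
- by rewrite F'E => x; exact: cvg_cst.
- by rewrite F'E; apply: is_cvg_cst.
- by rewrite F'E; apply: is_cvg_cst.
- apply: (cvg_comp (fun x => a * x) (fun y => y + b)); last exact: cvg_addrr_Ny.
  by apply/gt0_cvgMrNy => //; exact: cvg_id.
- apply: (cvg_comp (fun x => a * x) (fun y => y + b)); last exact: cvg_addrr.
  by apply/gt0_cvgMry => //; exact: cvg_id.
Qed.

Lemma ge0_integral_shift (f : R -> R) (b : R) :
  continuous f -> (forall x, 0 <= f x) ->
  (\int[leb]_x (f (x + b))%:E = \int[leb]_x (f x)%:E)%E.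
Proof.
move=> cf f0; rewrite [RHS](@ge0_integral_affine _ 1 b)//.
by apply: eq_integral => x _; rewrite !mul1r.
Qed.

End AffineSubstitution.

Section HeatKernel.
Context (R : realType).
Local Notation leb := (@lebesgue_measure R).

Lemma heat_kernelE (s : R) : 0 < s ->
  heat_kernel s = normal_pdf 0 (Num.sqrt (2 * s)).
Proof.
move=> s0; have s20 : 0 < 2 * s by rewrite mulr_gt0.
apply/funext => x; rewrite normal_pdfE ?gt_eqF ?sqrtr_gt0//.
rewrite /heat_kernel /normal_peak /normal_fun subr0 sqr_sqrtr ?ltW//.
by congr ((Num.sqrt _)^-1 * expR (_ / _)); rewrite -mulr_natl; ring.
Qed.

Lemma heat_kernel_gt0 (s x : R) : 0 < s -> 0 < heat_kernel s x.
Proof.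
move=> s0; rewrite mulr_gt0 ?expR_gt0// invr_gt0 sqrtr_gt0.
by rewrite !mulr_gt0 ?pi_gt0.
Qed.

Lemma heat_kernelN (s x : R) : heat_kernel s (- x) = heat_kernel s x.
Proof. by rewrite /heat_kernel sqrrN. Qed.

Lemma continuous_heat_kernel (s : R) : 0 < s -> continuous (@heat_kernel R s).
Proof.
move=> s0; rewrite heat_kernelE//; apply: continuous_normal_pdf.
by rewrite gt_eqF// sqrtr_gt0 mulr_gt0.
Qed.

Lemma prob_density_heat_kernel (s : R) : 0 < s ->
  prob_density (@heat_kernel R s).
Proof.
move=> s0; split.
- by apply: continuous_measurable_fun; exact: continuous_heat_kernel.
- by move=> x; exact/ltW/heat_kernel_gt0.
- by rewrite heat_kernelE//; exact: integral_normal_pdf.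
Qed.

Lemma is_derive_heat_kernel (s x : R) : 0 < s ->
  is_derive x 1 (heat_kernel s) (- x / (2 * s) * heat_kernel s x).
Proof.
move=> s0; rewrite /heat_kernel.
apply: is_derive_eq; rewrite /GRing.scale /=.
by field; rewrite !gt_eqF// sqrtr_gt0 !mulr_gt0// pi_gt0.
Qed.

End HeatKernel.

(** * The Gaussian law and Stein's identity *)

Section Gaussian.
Context (R : realType).
Local Notation leb := (@lebesgue_measure R).

(** The normal density of variance 2, not 1: with this choice [s * z] has the heat kernel at time
    [s ^+ 2] as its density for [s > 0]. *)
Definition gauss : R -> R := heat_kernel 1.

Lemma prob_density_gauss : prob_density gauss.
Proof. exact: prob_density_heat_kernel. Qed.

Definition gauss_prob : probability (measurableTypeR R) R :=
  density_measure prob_density_gauss.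
Local Notation nu := gauss_prob.

Lemma continuous_gauss : continuous gauss.
Proof. exact: continuous_heat_kernel. Qed.

Lemma gauss_gt0 x : 0 < gauss x.
Proof. exact: heat_kernel_gt0. Qed.

Lemma measurable_gauss : measurable_fun setT gauss.
Proof. by have [] := prob_density_gauss. Qed.

Lemma ge0_integral_gauss_prob (f : R -> \bar R) :
  measurable_fun setT f -> (forall x, 0 <= f x)%E ->
  (\int[nu]_x f x = \int[leb]_x (f x * (gauss x)%:E))%E.
Proof. exact: ge0_integral_density. Qed.

Lemma integral_gauss_prob (f : R -> \bar R) :
  measurable_fun setT f ->
  (\int[nu]_x f x = \int[leb]_x (f x * (gauss x)%:E))%E.
Proof. exact: integral_density. Qed.

(** Half of the exponent absorbs the polynomial factor, because [x^2 / 8 <= exp (x^2 / 8)]. This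
    yields both the second moment of [gauss] and its decay at infinity. *)
Lemma sqr_gauss_le : exists2 c : R, 0 < c &
  forall x, x ^+ 2 * gauss x <= c * heat_kernel 2 x.
Proof.
pose k1 := (Num.sqrt (4 * pi * 1) : R)^-1.
pose k2 := (Num.sqrt (4 * pi * 2) : R)^-1.
have k10 : 0 < k1 by rewrite invr_gt0 sqrtr_gt0 !mulr_gt0// pi_gt0.
have k20 : 0 < k2 by rewrite invr_gt0 sqrtr_gt0 !mulr_gt0// pi_gt0.
exists (8 * k1 / k2) => [|x]; first by rewrite !mulr_gt0// invr_gt0.
rewrite /gauss /heat_kernel -/k1 -/k2.
rewrite [leRHS](_ : _ = 8 * k1 * expR (- x ^+ 2 / (4 * 2))); last first.
  by field; rewrite gt_eqF.
rewrite [leLHS](_ : _ = k1 * (x ^+ 2 * expR (- x ^+ 2 / (4 * 1)))); last by ring.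
rewrite [8 * k1]mulrC -[leRHS]mulrA ler_pM2l//.
rewrite (_ : - x ^+ 2 / (4 * 1) = - x ^+ 2 / (4 * 2) + - (x ^+ 2 / 8)); last by field.
rewrite expRD mulrCA [8 * _]mulrC ler_pM2l ?expR_gt0// expRN.
rewrite ler_pdivrMr ?expR_gt0//.
have := expR_ge1Dx (x ^+ 2 / 8); lra.
Qed.

Lemma gauss_sqr_integrable : nu.-integrable setT (fun z : R => (z ^+ 2)%:E).
Proof.
have [c c0 cP] := sqr_gauss_le.
have mX : measurable_fun setT (fun z : R => (z ^+ 2)%:E).
  by apply/measurable_EFinP; exact: measurable_funX.
apply/integrableP; split => //.
rewrite ge0_integral_gauss_prob//; last exact: measurableT_comp.
apply: (@le_lt_trans _ _ (\int[leb]_x (c%:E * (heat_kernel 2 x)%:E))%E).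
  apply: ge0_le_integral => //.
  - by move=> x _; rewrite lee_fin mulr_ge0 ?normr_ge0// ltW// gauss_gt0.
  - apply: emeasurable_funM; first exact: measurableT_comp.
    by apply/measurable_EFinP; exact: measurable_gauss.
  - apply/measurable_EFinP/measurable_funM => //.
    by have [] := @prob_density_heat_kernel R 2 ltac:(by []).
  - by move=> x _; rewrite /= ger0_norm ?sqr_ge0// lee_fin.
have [m2 p2 i2] := @prob_density_heat_kernel R 2 ltac:(by []).
rewrite ge0_integralZl//; first by rewrite i2 mule1 ltry.
- exact/measurable_EFinP.
- by move=> x _; rewrite lee_fin.
- by rewrite lee_fin ltW.
Qed.

Lemma gauss_norm_integrable : nu.-integrable setT (fun z : R => `|z|%:E).
Proof.
apply: (@integrable_dominated _ (measurableTypeR R) R nu (fun z : R => `|z|)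
  (fun z : R => 1 + z ^+ 2)).
- exact: measurableT_comp.
- move=> x; rewrite normr_id ler_norml; apply/andP; split; nra.
- apply: integrable_addR; last exact: gauss_sqr_integrable.
  exact: (@finite_measure_integrable_cst _ _ _ nu).
Qed.

(* The integrand of [nu] is the derivative of [gauss * phi]. *)
Lemma gauss_stein (phi dphi : R -> R) (B : R) :
  (forall x : R, is_derive x 1 phi (dphi x)) -> continuous dphi ->
  (forall x, `|phi x| <= B) -> (forall x, `|dphi x| <= B) ->
  \int[nu]_z (z * phi z) = 2 * \int[nu]_z dphi z.
Proof.
move=> dphiP cdphi phiB dphiB.
have cphi : continuous phi.
  move=> x; apply: differentiable_continuous; apply/derivable1_diffP.
  by have [] := dphiP x.
have mphi : measurable_fun setT phi by exact: continuous_measurable_fun.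
have mdphi : measurable_fun setT dphi by exact: continuous_measurable_fun.
have idphi : nu.-integrable setT (EFin \o dphi).
  exact: (bounded_integrable nu mdphi dphiB).
have izphi : nu.-integrable setT (fun z => (z * phi z)%:E).
  apply: (@integrable_dominated _ (measurableTypeR R) R nu (fun z : R => z * phi z)
    (fun z : R => B * `|z|)).
  - exact: measurable_funM.
  - by move=> x; rewrite normrM mulrC ler_wpM2r.
  - by apply: integrable_scaleR; exact: gauss_norm_integrable.
(* Since [gauss' = - z / 2 * gauss], the product [h * gauss] is the derivative of [gauss * phi]. The
   identity amounts to [h] having mean zero. *)
pose h z := dphi z - z / 2 * phi z.
have ch : continuous h.
  move=> x; apply: cvgB; first exact: cdphi.
  apply: cvgM; last exact: cphi.
  by apply: cvgM; [exact: cvg_id|exact: cvg_cst].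
have izphi2 : nu.-integrable setT (fun z => (z / 2 * phi z)%:E).
  rewrite (_ : (fun _ => _) = (fun z => (2^-1 * (z * phi z))%:E)).
    exact: integrable_scaleR.
  by apply/funext => z; congr EFin; ring.
have ih : nu.-integrable setT (fun z => (h z)%:E) by exact: integrable_subR.
suff h0 : \int[nu]_z h z = 0.
  move: h0; rewrite RintegralB//.
  rewrite [X in _ - X](_ : _ = 2^-1 * \int[nu]_z (z * phi z)).
    by move=> ?; lra.
  rewrite -RintegralZl//; apply: eq_Rintegral => z _; ring.
pose f z := h z * gauss z.
have cf : continuous f.
  by move=> x; apply: cvgM; [exact: ch|exact: continuous_gauss].
have mf : measurable_fun setT f by exact: continuous_measurable_fun.
have mh : measurable_fun setT h by exact: continuous_measurable_fun.
have intf : leb.-integrable setT (EFin \o f).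
  apply/integrableP; split; first exact/measurable_EFinP.
  have /integrableP[_] := ih.
  rewrite ge0_integral_gauss_prob//; last first.
    by apply: measurableT_comp => //; exact/measurable_EFinP.
  under eq_integral => x _ do
    rewrite -(@gee0_abs _ (gauss x)%:E) ?lee_fin ?(ltW (gauss_gt0 x))// -abseM -EFinM.
  by [].
have -> : \int[nu]_z h z = fine (\int[leb]_x (f x)%:E)%E.
  rewrite /Rintegral integral_gauss_prob//; last exact/measurable_EFinP.
have dG (x : R) : is_derive x 1 (fun t => gauss t * phi t) (f x).
  apply: (is_derive_eq (derive_mul_rule (is_derive_heat_kernel x ltr01) (dphiP x))).
  by rewrite /f /h /gauss; field.
pose I (n : nat) : set R := `[- n.+1%:R, n.+1%:R]%classic.
have FTC (n : nat) : (\int[leb]_(x in I n) (f x)%:E =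
    (gauss n.+1%:R * phi n.+1%:R - gauss (- n.+1%:R) * phi (- n.+1%:R))%R%:E)%E.
  have n0 : 0 < n.+1%:R :> R by [].
  rewrite EFinB; apply: (@continuous_FTC2 _ f (fun t => gauss t * phi t)).
  - by apply: (@lt_trans _ _ 0) => //; rewrite oppr_lt0.
  - exact: continuous_subspaceT.
  - have cG : continuous (fun t => gauss t * phi t).
      by move=> x; apply: cvgM; [exact: continuous_gauss|exact: cphi].
    split.
    + by move=> x _; have [] := dG x.
    + exact/cvg_at_right_filter/cG.
    + exact/cvg_at_left_filter/cG.
  - by move=> x _; rewrite derive1E; exact: derive_val.
have [c c0 cP] := sqr_gauss_le.
pose k2 := (Num.sqrt (4 * pi * 2) : R)^-1.
have k20 : 0 < k2 by rewrite invr_gt0 sqrtr_gt0 !mulr_gt0// pi_gt0.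
have B0 : 0 <= B by rewrite (le_trans _ (phiB 0)).
(* A decay of order [1 / n] is enough for the boundary terms, [phi] being bounded; it follows from
   [n <= n^2] and the bound on [x^2 * gauss x]. *)
have gn (n : nat) : gauss n.+1%:R <= c * k2 * n.+1%:R^-1.
  rewrite ler_pdivlMr//; apply: le_trans (_ : n.+1%:R ^+ 2 * gauss n.+1%:R <= _).
    rewrite mulrC ler_wpM2r ?(ltW (gauss_gt0 _))//.
    by rewrite expr2 ler_peMr// ler1n.
  apply: le_trans (cP _) _; rewrite ler_wpM2l ?(ltW c0)//.
  rewrite /heat_kernel -/k2 ler_piMr ?(ltW k20)//.
have lim0 : (fun n : nat => \int[leb]_(x in I n) (f x)%:E)%E @ \oo --> 0%E.
  apply/fine_cvgP; split; first by near=> n; rewrite FTC.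
  apply/cvgr0Pnorm_le => e e0.
  have : harmonic @ \oo --> (0 : R) by exact: cvg_harmonic.
  move=> /cvgr0Pnorm_le/(_ (e / (2 * B * c * k2 + 1))).
  have K0 : 0 < 2 * B * c * k2 + 1.
    by apply: ltr_wpDl => //; rewrite !mulr_ge0 ?(ltW c0) ?(ltW k20).
  rewrite divr_gt0// => /(_ isT); apply: filterS => n.
  rewrite /= FTC/= /harmonic ger0_norm ?invr_ge0// ler_pdivlMr// => ne.
  rewrite [gauss (- _)]heat_kernelN -mulrBr normrM ger0_norm ?(ltW (gauss_gt0 _))//.
  apply: le_trans ne; rewrite mulrDr mulr1.
  have h1 : `|phi n.+1%:R - phi (- n.+1%:R)| <= 2 * B.
    by apply: le_trans (ler_normB _ _) _; rewrite mulr_natl mulr2n lerD.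
  apply: (@le_trans _ _ (c * k2 * n.+1%:R^-1 * (2 * B))).
    by apply: ler_pM => //; rewrite ?(ltW (gauss_gt0 _)).
  rewrite [leLHS](_ : _ = n.+1%:R^-1 * (2 * B * c * k2)); last by ring.
  by rewrite lerDl invr_ge0.
(* The integrals over [I n] tend to the full integral by domination and to 0 by the fundamental
   theorem of calculus; uniqueness of limits concludes. *)
have := @dominated_convergence _ _ _ leb setT measurableT
  (fun n => (EFin \o f) \_ (I n)) (EFin \o f) (abse \o (EFin \o f)).
case.
- move=> n; apply/(measurable_restrictT (EFin \o f)); first exact: measurable_itv.
  by apply: measurable_funTS; exact/measurable_EFinP.
- exact/measurable_EFinP.
- apply/aeW => x _; apply: (@cvg_near_cst); near=> n.
  rewrite patchE mem_set// /I /= in_itv/= -ler_norml.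
  near: n; apply: filterS (nbhs_infty_ger `|x|) => n /le_trans; apply.
  by rewrite ler_nat.
- exact: integrable_abse.
- apply/aeW => x n _; rewrite patchE; case: ifPn => // _.
  by rewrite abse0 /= lee_fin.
move=> _ _ /= lim1.
suff -> : (\int[leb]_x (f x)%:E)%E = 0%E by [].
rewrite -(cvg_lim (@ereal_hausdorff R) lim1) -(cvg_lim (@ereal_hausdorff R) lim0).
by apply: congr_lim; apply/funext => n; rewrite [RHS]integral_mkcond.
Unshelve. all: by end_near. Qed.

End Gaussian.

(** * Gaussian smoothing *)

Section IntegralAlongCurve.
Context (R : realType) (P : probability (measurableTypeR R) R).

Lemma measurable_affine_comp (f : R -> R) (a b : R) :
  measurable_fun setT f -> measurable_fun setT (fun y => f (a + b * y)).
Proof.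
move=> mf; apply: measurableT_comp => //.
by apply: measurable_funD => //; exact: measurable_funM.
Qed.

Lemma is_derive_continuous (f df : R -> R) :
  (forall x : R, is_derive x 1 f (df x)) -> continuous f.
Proof.
move=> fP x; apply: differentiable_continuous; apply/derivable1_diffP.
by have [] := fP x.
Qed.

Lemma continuous_measurable (f : R -> R) :
  continuous f -> measurable_fun setT f.
Proof. exact: continuous_measurable_fun. Qed.

(** On []u, v[] the derivative of the integrand is dominated by [B * (C + c * |y|)]. Integrability
    is asked of [c * |y|] and not of [|y|]: when [b] is constant, [c = 0] is allowed and [P] may be
    any probability, with or without moments. *)
Lemma is_derive_integral_curve (phi dphi a b da db : R -> R) (B C c u v t : R) :
  (forall x : R, is_derive x 1 phi (dphi x)) -> continuous dphi ->
  (forall x, `|phi x| <= B) -> (forall x, `|dphi x| <= B) ->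
  u < t < v ->
  (forall s : R, u < s < v -> is_derive s 1 a (da s)) ->
  (forall s : R, u < s < v -> is_derive s 1 b (db s)) ->
  (forall s : R, u < s < v -> `|da s| <= C) ->
  (forall s : R, u < s < v -> `|db s| <= c) ->
  P.-integrable setT (fun y : R => (c * `|y|)%:E) ->
  is_derive t 1 (fun s => \int[P]_y phi (a s + b s * y))
    (\int[P]_y (dphi (a t + b t * y) * (da t + db t * y))).
Proof.
move=> phiP cdphi phiB dphiB tuv aP bP daC dbc intc.
have B0 : 0 <= B by rewrite (le_trans _ (phiB 0)).
have mphi := continuous_measurable (is_derive_continuous phiP).
have df s y : u < s < v -> is_derive s 1 (fun s => phi (a s + b s * y))
    (dphi (a s + b s * y) * (da s + db s * y)).
  move=> suv; apply: (@derive_comp_rule _ phi (fun s => a s + b s * y)) => //.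
  apply: (is_derive_eq (derive_add_rule (aP s suv)
    (derive_mul_rule (bP s suv) (derive_cst_rule y s)))).
  by rewrite mulr0 addr0.
have I s : (`]u, v[%classic : set R) s -> u < s < v by rewrite /= in_itv.
have It : (`]u, v[%classic : set R) t by rewrite /= in_itv.
have intphi s : P.-integrable setT (EFin \o (fun y => phi (a s + b s * y))).
  by apply: (@bounded_integrable _ _ _ P _ B) => //; exact: measurable_affine_comp.
have derf s y : (`]u, v[%classic : set R) s -> [set: measurableTypeR R] y ->
    derivable (fun s => phi (a s + b s * y)) s 1.
  by move=> /I suv _; have [] := df s y suv.
have intG : P.-integrable setT (EFin \o (fun y : R => B * (C + c * `|y|))).
  apply: integrable_scaleR; apply: integrable_addR => //.
  exact: (@finite_measure_integrable_cst _ _ _ P).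
have derfB s y : (`]u, v[%classic : set R) s -> [set: measurableTypeR R] y ->
    `|partial1of2 (fun s y => phi (a s + b s * y)) s y| <= B * (C + c * `|y|).
  move=> /I suv _; rewrite partial1of2E.
  have -> := @derive_val _ _ _ _ _ _ _ (df s y suv).
  rewrite normrM ler_pM//.
  rewrite (le_trans (ler_normD _ _))// lerD ?daC// normrM ler_wpM2r// dbc//.
have G0 (y : R) : 0 <= B * (C + c * `|y|).
  rewrite mulr_ge0// addr_ge0//; first by rewrite (le_trans _ (daC t tuv)).
  by rewrite mulr_ge0// (le_trans _ (dbc t tuv)).
apply: DeriveDef.
  exact: (derivable_under_integral measurableT It (fun s _ => intphi s) derf G0
    intG derfB).
rewrite -derive1E (differentiation_under_integral measurableT It
  (fun s _ => intphi s) derf G0 intG derfB).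
apply: eq_Rintegral => y _; rewrite partial1of2E.
by have -> := @derive_val _ _ _ _ _ _ _ (df t y tuv).
Qed.

Lemma continuous_integral_curve (phi a b : R -> R) (B : R) :
  continuous phi -> (forall x, `|phi x| <= B) -> continuous a -> continuous b ->
  continuous (fun s => \int[P]_y phi (a s + b s * y)).
Proof.
move=> cphi phiB ca cb t.
have tI : t \in (`]t - 1, t + 1[%classic : set R).
  by rewrite inE/= in_itv/=; apply/andP; split; lra.
have mphi := continuous_measurable cphi.
apply: (@continuity_under_integral _ _ _ P (fun s y => phi (a s + b s * y))
  setT measurableT (t - 1) (t + 1) _ _ (cst B) _ _ t tI).
- move=> s _; apply: (@bounded_integrable _ _ _ P _ B) => //.
  exact: measurable_affine_comp.
- apply/aeW => y _ s _; apply: (@continuous_comp _ _ _ (fun s => a s + b s * y) phi).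
    by apply: cvgD; [exact: ca|apply: cvgM; [exact: cb|exact: cvg_cst]].
  exact: cphi.
- exact: (@finite_measure_integrable_cst _ _ _ P).
- by move=> s _; apply/aeW => y _; exact: phiB.
Qed.

End IntegralAlongCurve.

(** A zero integral would make [f] vanish almost everywhere, hence make the whole space null,
    against total mass one. *)
Lemma Rintegral_gt0 d (X : measurableType d) (R : realType)
    (P : probability X R) (f : X -> R) :
  P.-integrable setT (fun x => (f x)%:E) -> (forall x, 0 < f x) ->
  0 < \int[P]_x f x.
Proof.
move=> intf f0; have /integrableP[mf _] := intf.
rewrite lt_neqAle Rintegral_ge0 ?andbT; last by move=> x _; exact: ltW.
apply/negP => /eqP/esym int0.
have int0' : (\int[P]_x `|(f x)%:E| = 0)%E.
  under eq_integral do rewrite gee0_abs ?lee_fin ?(ltW (f0 _))//.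
  by rewrite -(fineK (integrable_fin_num measurableT intf)) [fine _]int0.
have /(ae_eq_integral_abs _ measurableT mf) [A [mA A0 subA]] := int0'.
have : P setT = 0%E.
  apply/eqP; rewrite -measure_le0 -A0 le_measure ?inE//.
  move=> x _; apply: subA => /= /(_ I) [] fx0.
  by move: (f0 x); rewrite fx0 ltxx.
by rewrite probability_setT => /eqP; rewrite onee_eq0.
Qed.

Lemma Rintegral_bound d (X : measurableType d) (R : realType)
    (P : probability X R) (f : X -> R) (B : R) :
  measurable_fun setT f -> (forall x, `|f x| <= B) -> `|\int[P]_x f x| <= B.
Proof.
move=> mf fB; have int := bounded_integrable P mf fB.
apply: le_trans (le_normr_Rintegral measurableT int) _.
apply: (@le_trans _ _ (\int[P]_x (cst B x))).
  apply: le_Rintegral => //.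
  - exact: (integrable_abse int).
  - exact: (@finite_measure_integrable_cst _ _ _ P).
by rewrite Rintegral_cst//= probability_setT mulr1.
Qed.

Section Mixture.
Context (R : realType) (P : probability (measurableTypeR R) R).
Local Notation leb := (@lebesgue_measure R).

(** By Tonelli and translation invariance each translate contributes the full integral of [f], and
    [P] has mass one. This preserves total mass, and it later reduces Jensen's inequality to a
    pointwise one. *)
Lemma integral_mixture (f : R -> R) (s : R) : continuous f -> (forall x, 0 <= f x) ->
  (\int[leb]_x \int[P]_z (f (x + s * z))%:E = \int[leb]_x (f x)%:E)%E.
Proof.
move=> cf f0.
rewrite (@fubini_tonelli _ _ (measurableTypeR R) (measurableTypeR R) R leb P
  (fun p => (f (p.1 + s * p.2))%:E)) /=; last 2 first.
- apply/measurable_EFinP; apply: measurableT_comp.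
    exact: continuous_measurable.
  apply: measurable_funD; first exact: measurable_fst.
  by apply: measurable_funM => //; exact: measurable_snd.
- by move=> p; rewrite lee_fin.
under eq_integral do rewrite ge0_integral_shift//.
by rewrite integral_cst//= probability_setT mule1.
Qed.

End Mixture.

Section Smear.
Context (R : realType).
Local Notation leb := (@lebesgue_measure R).
Local Notation nu := (gauss_prob R).
Implicit Types (f : R -> R) (B s x : R).

(* [smear f s] is the convolution of [f] with the heat kernel at time [s ^+ 2],
   written as an expectation; it makes sense at [s = 0]. *)
Definition smear (f : R -> R) (s x : R) : R := \int[nu]_z f (x + s * z).

Lemma smear0 f x : smear f 0 x = f x.
Proof.
rewrite /smear; under eq_Rintegral do rewrite mul0r addr0.
by rewrite Rintegral_cst//= probability_setT mulr1.
Qed.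

Lemma smear_integrable f B s x : continuous f -> (forall y, `|f y| <= B) ->
  nu.-integrable setT (fun z => (f (x + s * z))%:E).
Proof.
move=> cf fB; apply: (@bounded_integrable _ _ _ nu _ B) => //.
by apply: measurable_affine_comp; exact: continuous_measurable.
Qed.

Lemma smear_EFin f B s x : continuous f -> (forall y, `|f y| <= B) ->
  (smear f s x)%:E = (\int[nu]_z (f (x + s * z))%:E)%E.
Proof.
move=> cf fB; rewrite /smear fineK//.
exact/integrable_fin_num/(smear_integrable _ _ cf fB).
Qed.

Lemma smear_bound f B s x : continuous f -> (forall y, `|f y| <= B) ->
  `|smear f s x| <= B.
Proof.
move=> cf fB; apply: Rintegral_bound => //.
by apply: measurable_affine_comp; exact: continuous_measurable.
Qed.

Lemma smear_gt0 f B s x : continuous f -> (forall y, `|f y| <= B) ->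
  (forall y, 0 < f y) -> 0 < smear f s x.
Proof.
move=> cf fB f0; apply: Rintegral_gt0 => //.
exact: smear_integrable cf fB.
Qed.

Lemma is_derive_smear f df B s (x : R) :
  (forall y : R, is_derive y 1 f (df y)) -> continuous df ->
  (forall y, `|f y| <= B) -> (forall y, `|df y| <= B) ->
  is_derive x 1 (smear f s) (smear df s x).
Proof.
move=> fP cdf fB dfB.
apply: is_derive_eq.
  apply: (@is_derive_integral_curve _ nu f df (fun x => x) (fun=> s) (fun=> 1)
    (fun=> 0) B 1 0 (x - 1) (x + 1)) => //.
  - by apply/andP; split; lra.
  - by move=> y _; rewrite normr1.
  - by move=> y _; rewrite normr0.
  - by apply: integrable_scaleR; exact: gauss_norm_integrable.
by apply: eq_Rintegral => z _; rewrite mul0r addr0 mulr1.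
Qed.

Lemma continuous_smear_curve f B (Z : R -> R) :
  continuous f -> (forall y, `|f y| <= B) -> continuous Z ->
  continuous (fun s => smear f s (Z s)).
Proof.
move=> cf fB cZ.
apply: (@continuous_integral_curve _ nu f Z (fun s => s) B) => // x.
exact: cvg_id.
Qed.

Lemma continuous_smear f B s :
  continuous f -> (forall y, `|f y| <= B) -> continuous (smear f s).
Proof.
move=> cf fB; apply: (@continuous_integral_curve _ nu f (fun x => x) (fun=> s) B) => //.
- by move=> x; exact: cvg_id.
- by move=> x; exact: cvg_cst.
Qed.

(* Stein's identity turns the derivative in the width [s] into a second
   derivative in space. *)
Lemma is_derive_smear_curve f f1 f2 B (Z dZ : R -> R) (t : R) :
  (forall y : R, is_derive y 1 f (f1 y)) ->
  (forall y : R, is_derive y 1 f1 (f2 y)) -> continuous f2 ->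
  (forall y, `|f y| <= B) -> (forall y, `|f1 y| <= B) ->
  (forall y, `|f2 y| <= B) ->
  (forall s : R, is_derive s 1 Z (dZ s)) -> {for t, continuous dZ} ->
  is_derive t 1 (fun s => smear f s (Z s))
    (dZ t * smear f1 t (Z t) + 2 * t * smear f2 t (Z t)).
Proof.
move=> fP f1P cf2 fB f1B f2B ZP cdZ.
have cf1 := is_derive_continuous f1P.
have B0 : 0 <= B by rewrite (le_trans _ (fB 0)).
(* Continuity of [dZ] at [t] supplies an interval on which [|dZ|] is at most [|dZ t| + 1], the local
   bound that differentiation under the integral requires. *)
have /cvgrPdist_lt/(_ 1 ltr01)[e /= e0 eP] := cdZ.
have intN c : nu.-integrable setT (fun z : R => (c * `|z|)%:E).
  by apply: integrable_scaleR; exact: gauss_norm_integrable.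
apply: is_derive_eq.
  apply: (@is_derive_integral_curve _ nu f f1 Z (fun s => s) dZ
    (fun=> 1) B (`|dZ t| + 1) 1 (t - e) (t + e)) => //.
  - by rewrite ltrBlDr ltrDl e0.

  - move=> s /andP[ts st]; have : `|dZ t - dZ s| < 1.
      by apply: eP; rewrite /= ltr_norml; apply/andP; split; lra.
    move=> h; rewrite -[dZ s](subKr (dZ t)).
    by apply: le_trans (ler_normB _ _) _; rewrite lerD2l ltW.
  - by move=> s _; rewrite normr1.
have int1 := smear_integrable t (Z t) cf1 f1B.
have intz : nu.-integrable setT (fun z : R => (z * f1 (Z t + t * z))%:E).
  apply: (@integrable_dominated _ (measurableTypeR R) R nu _ (fun z : R => B * `|z|)) => //.
  - apply: measurable_funM => //.
    by apply: measurable_affine_comp; exact: continuous_measurable.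
  - by move=> z; rewrite normrM mulrC ler_wpM2r.
transitivity (\int[nu]_z (dZ t * f1 (Z t + t * z) + z * f1 (Z t + t * z))).
  by apply: eq_Rintegral => z _; ring.
rewrite RintegralD//; last exact: integrable_scaleR.
rewrite RintegralZl//; congr (_ + _).
have -> : \int[nu]_z (z * f1 (Z t + t * z)) =
    2 * \int[nu]_z (t * f2 (Z t + t * z)).
  (* The function has derivative [t * f2], so nothing is divided by [t] and [t = 0] is included;
     [B * (1 + |t|)] bounds both functions at once. *)
  apply: (@gauss_stein _ (fun z => f1 (Z t + t * z)) _ (B * (1 + `|t|))).
  - move=> z; rewrite mulrC.
    apply: (@derive_comp_rule _ f1 (fun z => Z t + t * z)) => //.
    apply: (is_derive_eq (derive_add_rule (derive_cst_rule (Z t) z)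
      (derive_mul_rule (derive_cst_rule t z) (derive_id_rule z)))).
    by ring.
  - move=> z; apply: cvgM; first exact: cvg_cst.
    apply: (@continuous_comp _ _ _ (fun z => Z t + t * z) f2); last exact: cf2.
    by apply: cvgD; [exact: cvg_cst|apply: cvgM; [exact: cvg_cst|exact: cvg_id]].
  - by move=> z; rewrite (le_trans (f1B _))// ler_peMr// lerDl.
  - by move=> z; rewrite normrM mulrC ler_pM// lerDr.
rewrite RintegralZl//; first by rewrite mulrA.
exact: smear_integrable cf2 f2B.
Qed.

End Smear.

(** * Moments and Jensen inequality for smoothed densities *)

Section EvenPowers.
Context (R : realType).
Implicit Types c y : R.

(** Convexity of the even powers as tangent line inequalities; in the three degrees that [C_const]
    uses, the gap is [(y - c) ^+ 2] times a nonnegative factor. *)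
Lemma tangent_pow2 c y : 2 * c ^+ 1 * y - 1 * c ^+ 2 <= y ^+ 2.
Proof.
rewrite -subr_ge0 (_ : _ - _ = (y - c) ^+ 2); last by ring.
exact: sqr_ge0.
Qed.

Lemma tangent_pow4 c y : 4 * c ^+ 3 * y - 3 * c ^+ 4 <= y ^+ 4.
Proof.
rewrite -subr_ge0 (_ : _ - _ = (y - c) ^+ 2 * ((y + c) ^+ 2 + 2 * c ^+ 2)).
  apply: mulr_ge0 (sqr_ge0 _) _; apply: addr_ge0 (sqr_ge0 _) _.
  exact: mulr_ge0 (ler0n _ _) (sqr_ge0 _).
by ring.
Qed.

Lemma tangent_pow6 c y : 6 * c ^+ 5 * y - 5 * c ^+ 6 <= y ^+ 6.
Proof.
rewrite -subr_ge0 (_ : _ - _ = (y - c) ^+ 2 *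
  ((y ^+ 2 + y * c) ^+ 2 + 2 * (y * c + c ^+ 2) ^+ 2 + 3 * (c ^+ 2) ^+ 2)).
  apply: mulr_ge0 (sqr_ge0 _) _; apply: addr_ge0.
    apply: addr_ge0 (sqr_ge0 _) _; exact: mulr_ge0 (ler0n _ _) (sqr_ge0 _).
  exact: mulr_ge0 (ler0n _ _) (sqr_ge0 _).
by ring.
Qed.

End EvenPowers.

Section MixtureSecondMoment.
Context (R : realType) (P : probability (measurableTypeR R) R).
Local Notation leb := (@lebesgue_measure R).

(** After Tonelli the slice at [z] is the second moment of a translate of [w], controlled by
    [(x - s z)^2 <= 2 x^2 + 2 s^2 z^2]. The inner integral stays extended-valued, so that the lemma
    serves both for [smear] and for the convolution of the heat kernel with a merely measurable
    density. *)
Lemma second_moment_mixture (w : R -> R) (s : R) :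
  prob_density w -> continuous w -> finite_second_moment w ->
  P.-integrable setT (fun z : R => (z ^+ 2)%:E) ->
  (\int[leb]_x ((x ^+ 2)%:E * \int[P]_z (w (x + s * z))%:E) < +oo)%E.
Proof.
move=> hw cw M2 P2; have [_ w0 w1] := hw; rewrite /finite_second_moment in M2.
have mw := continuous_measurable cw.
have msmear (x : R) : measurable_fun setT (fun z : R => (w (x + s * z))%:E).
  by apply/measurable_EFinP; exact: measurable_affine_comp.
under eq_integral => x _.
  rewrite -ge0_integralZl//; last 3 first.
  - exact: msmear.
  - by move=> z _; rewrite lee_fin.
  - by rewrite lee_fin sqr_ge0.
  over.
pose f (p : R * R) := ((p.1 ^+ 2)%:E * (w (p.1 + s * p.2))%:E)%E.
have f0 p : (0 <= f p)%E by rewrite mule_ge0 ?lee_fin ?sqr_ge0.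
have mf : measurable_fun setT f.
  apply: emeasurable_funM.
    by apply/measurable_EFinP; apply: measurable_funX; exact: measurable_fst.
  apply/measurable_EFinP; apply: measurableT_comp => //.
  apply: measurable_funD; first exact: measurable_fst.
  by apply: measurable_funM => //; exact: measurable_snd.
have tonelli := @fubini_tonelli _ _ (measurableTypeR R) (measurableTypeR R) R
  leb P f mf f0.
rewrite [ltLHS]tonelli /f /=.
have K0 (z : R) : 0 <= 2 * s ^+ 2 * z ^+ 2.
  by rewrite mulr_ge0 ?sqr_ge0 // mulr_ge0 ?sqr_ge0.
pose M : \bar R := (\int[leb]_x (x ^+ 2 * w x)%:E)%E.
have M0 : (0 <= M)%E.
  by apply: integral_ge0 => x _; rewrite lee_fin mulr_ge0 ?sqr_ge0.
have mx2w : measurable_fun setT (fun x : R => (x ^+ 2 * w x)%:E).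
  by apply/measurable_EFinP/measurable_funM => //; exact: measurable_funX.
have slice (z : R) : (\int[leb]_x ((x ^+ 2)%:E * (w (x + s * z))%:E) <=
    2%:E * M + (2 * s ^+ 2 * z ^+ 2)%:E)%E.
  (* Writing [x] as [(x + s z) - s z] turns the integrand into a function of [x + s z] alone, to
     which translation invariance applies. *)
  rewrite [leLHS](_ : _ = \int[leb]_(x in setT)
      (((x + s * z) - s * z) ^+ 2 * w (x + s * z))%R%:E)%E; last first.
    by apply: eq_integral => x _; rewrite addrK EFinM.
  rewrite (@ge0_integral_shift _ (fun x => (x - s * z) ^+ 2 * w x)); last 2 first.
  - move=> x; apply: cvgM; last exact: cw.
    apply: (@continuous_comp _ _ _ (fun x => x - s * z) (fun x => x ^+ 2)).
      by apply: cvgB; [exact: cvg_id|exact: cvg_cst].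
    exact: sqr_continuous.
  - by move=> x; rewrite mulr_ge0 ?sqr_ge0//.
  apply: (@le_trans _ _ (\int[leb]_x (2%:E * (x ^+ 2 * w x)%:E +
      (2 * s ^+ 2 * z ^+ 2)%:E * (w x)%:E))%E).
    apply: ge0_le_integral => //.
    - by move=> x _; rewrite lee_fin mulr_ge0 ?sqr_ge0.
    - apply/measurable_EFinP/measurable_funM => //.
      by apply: measurable_funX; exact: measurable_funB.
    - apply: emeasurable_funD; apply: emeasurable_funM => //.
      exact/measurable_EFinP.
    - move=> x _; rewrite -!EFinM -EFinD lee_fin.
      have : (x - s * z) ^+ 2 <= 2 * x ^+ 2 + 2 * s ^+ 2 * z ^+ 2.
        by have := sqr_ge0 (x + s * z); nra.
      by move=> /(ler_wpM2r (w0 x)); rewrite mulrDl -[2 * _ * w x]mulrA.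
  rewrite ge0_integralD//; last 4 first.
  - by move=> x _; rewrite mule_ge0// lee_fin mulr_ge0// sqr_ge0.
  - by apply: emeasurable_funM.
  - move=> x _; apply: mule_ge0; rewrite lee_fin; last exact: w0.
    exact: K0.
  - by apply: emeasurable_funM => //; exact/measurable_EFinP.
  rewrite ge0_integralZl//; last first.
    by move=> x _; rewrite lee_fin mulr_ge0 ?sqr_ge0.
  rewrite ge0_integralZl//; last 3 first.
  - exact/measurable_EFinP.
  - by move=> x _; rewrite lee_fin.
  - by rewrite lee_fin K0.
  by rewrite w1 mule1.
apply: (@le_lt_trans _ _ (\int[P]_z (2%:E * M + (2 * s ^+ 2 * z ^+ 2)%:E))%E).
  apply: ge0_le_integral => //.
  - move=> z _; apply: integral_ge0 => x _.
    by rewrite -EFinM lee_fin mulr_ge0 ?sqr_ge0.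
  - exact: (@measurable_fun_fubini_tonelli_G _ _ (measurableTypeR R)
      (measurableTypeR R) R leb f mf f0).
  - apply: emeasurable_funD => //; apply/measurable_EFinP.
    by apply: measurable_funM => //; exact: measurable_funX.
rewrite ge0_integralD//; last 3 first.
- by move=> z _; rewrite mule_ge0.
- by move=> z _; rewrite lee_fin K0.
- by apply/measurable_EFinP/measurable_funM => //; exact: measurable_funX.
apply: lte_add_pinfty.
  rewrite integral_cst//= probability_setT mule1.
  by rewrite lte_mul_pinfty.
have /integrableP[_] := integrable_scaleR (2 * s ^+ 2) P2.
apply: le_lt_trans; apply: ge0_le_integral => //.
- by move=> z _; rewrite lee_fin K0.
- by apply/measurable_EFinP/measurable_funM => //; exact: measurable_funX.
- apply: measurableT_comp => //.
  by apply/measurable_EFinP/measurable_funM => //; exact: measurable_funX.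
- by move=> z _; rewrite lee_fin ler_norm.
Qed.

End MixtureSecondMoment.

Section SmearDensity.
Context (R : realType).
Local Notation leb := (@lebesgue_measure R).
Local Notation nu := (gauss_prob R).
Variables (w : R -> R) (B : R).
Hypotheses (hw : prob_density w) (cw : continuous w) (wB : forall x, `|w x| <= B).

Lemma prob_density_smear s : prob_density (smear w s).
Proof.
have [_ w0 w1] := hw; split.
- by apply: continuous_measurable; exact: (continuous_smear cw wB).
- by move=> x; apply: Rintegral_ge0 => z _.
- under eq_integral do rewrite (smear_EFin _ _ cw wB).
  by rewrite integral_mixture.
Qed.

Lemma finite_second_moment_smear s :
  finite_second_moment w -> finite_second_moment (smear w s).
Proof.
move=> M2; rewrite /finite_second_moment.
under eq_integral do rewrite EFinM (smear_EFin _ _ cw wB).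
exact: (@second_moment_mixture R nu w s hw cw M2 (@gauss_sqr_integrable R)).
Qed.

Hypothesis w_gt0 : forall x, 0 < w x.

(* Jensen's inequality for the perspective function [|a|^m / b^(m-1)],
   obtained by integrating its tangent plane at [(smear a, smear w)]. *)
Lemma integral_ratio_smear_le (m : nat) (a : R -> R) (s : R) :
  ~~ odd m -> (0 < m)%N ->
  (forall c y : R, m%:R * c ^+ m.-1 * y - m.-1%:R * c ^+ m <= y ^+ m) ->
  continuous a -> (forall x, `|a x| <= B) ->
  (\int[leb]_x (`|smear a s x / smear w s x| ^+ m * smear w s x)%:E <=
   \int[leb]_x (`|a x / w x| ^+ m * w x)%:E)%E.
Proof.
move=> modd m0 tangent ca aB.
have normX (y : R) : `|y| ^+ m = y ^+ m by rewrite -normrX ger0_norm ?exprn_even_ge0.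
have smear0 := smear_gt0 s _ cw wB w_gt0.
have csw := continuous_smear (s := s) cw wB.
have csa := continuous_smear (s := s) ca aB.
pose psi x := `|a x / w x| ^+ m * w x.
have psi0 x : 0 <= psi x by rewrite mulr_ge0 ?exprn_ge0 ?(ltW (w_gt0 _)).
have cratio (f g : R -> R) : continuous f -> continuous g -> (forall x, 0 < g x) ->
    continuous (fun x => `|f x / g x| ^+ m * g x).
  move=> cf cg g0 x; apply: cvgM; last exact: cg.
  apply: (@continuous_comp _ _ _ (fun x => `|f x / g x|) (fun y => y ^+ m)).
    apply: cvg_norm; apply: cvgM; first exact: cf.
    by apply: cvgV; [rewrite gt_eqF|exact: cg].
  exact: exprn_continuous.
have cpsi : continuous psi by exact: cratio.
have mpsi := continuous_measurable cpsi.
(* Once the right side is a mixture of translates, the comparison can be made separately at each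
   [x]. *)
rewrite -(integral_mixture (gauss_prob R) s cpsi)//.
have mcomp (x : R) : measurable_fun setT (fun z : R => (psi (x + s * z))%:E).
  by apply/measurable_EFinP; exact: measurable_affine_comp.
apply: ge0_le_integral => //.
- by move=> x _; rewrite lee_fin mulr_ge0 ?exprn_ge0 ?(ltW (smear0 _)).
- by apply/measurable_EFinP; apply: continuous_measurable; exact: cratio.
- apply: (@measurable_fun_fubini_tonelli_F _ _ (measurableTypeR R)
      (measurableTypeR R) R nu (fun p => (psi (p.1 + s * p.2))%:E)).
  + apply/measurable_EFinP; apply: measurableT_comp => //.
    apply: measurable_funD; first exact: measurable_fst.
    by apply: measurable_funM => //; exact: measurable_snd.
  + by move=> p; rewrite lee_fin.
move=> x _.
have [->|fin] := eqVneq (\int[nu]_z (psi (x + s * z))%:E)%E +oo%E.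
  exact: leey.
have intpsi : nu.-integrable setT (fun z : R => (psi (x + s * z))%:E).
  apply/integrableP; split; first exact: mcomp.
  under eq_integral do rewrite gee0_abs ?lee_fin//.
  by rewrite ltey.
rewrite -(fineK (integrable_fin_num measurableT intpsi)) lee_fin.
pose c := smear a s x / smear w s x.
have inta := smear_integrable s x ca aB.
have intw := smear_integrable s x cw wB.
(* The tangent functional [m c^(m-1) a - (m-1) c^m b] is linear, so it commutes with the integral.
   At the averages, whose ratio is [c], its value is [c^m * smear w]. *)
rewrite [leLHS](_ : _ = \int[nu]_z (m%:R * c ^+ m.-1 * a (x + s * z) -
    m.-1%:R * c ^+ m * w (x + s * z))); last first.
  rewrite RintegralB//; [|exact: integrable_scaleR..].
  rewrite !RintegralZl// -!/(smear _ _ _) normX -/c.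
  rewrite (_ : smear a s x = c * smear w s x); last by rewrite divfK// gt_eqF.
  have cm : c ^+ m = c * c ^+ m.-1 by rewrite -exprS prednK.
  have mm : m%:R = m.-1%:R + 1 :> R by rewrite natr1 prednK.
  by rewrite !cm mm; ring.
apply: le_Rintegral => //.
  by apply: integrable_subR; exact: integrable_scaleR.
move=> z _; rewrite /psi normX.
have wz := w_gt0 (x + s * z).
have := ler_wpM2r (ltW wz) (tangent c (a (x + s * z) / w (x + s * z))).
apply: le_trans; rewrite mulrBl -[X in _ <= X - _]mulrA divfK ?gt_eqF//.
Qed.

End SmearDensity.

Lemma Lnorm2E d (X : measurableType d) (R : realType)
    (mu : {measure set X -> \bar R}) (f : X -> R) :
  ('N[mu]_2%:E[EFin \o f] = sqrte (\int[mu]_x (f x ^+ 2)%:E))%E.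
Proof.
rewrite unlock poweR12_sqrt; last by apply: integral_ge0 => x _; exact: poweR_ge0.
congr sqrte; apply: eq_integral => x _.
by rewrite /= powR_mulrn// real_normK ?num_real.
Qed.

(** * Smooth positive densities and the constant [C] *)

Section SmoothDensity.
Context (R : realType).
Local Notation leb := (@lebesgue_measure R).

(** The class in which both regimes, [t0 > 0] and [t0 = 0], are treated; it is stable under
    smoothing and translation. Derivatives are explicit functions, so that smoothing acts on each of
    them, and one constant bounds them all. *)
Record smooth_density (B : R) (w w1 w2 w3 : R -> R) : Prop := SmoothDensity {
  smooth_prob : prob_density w;
  smooth_gt0 : forall x, 0 < w x;
  smooth_derive1 : forall x : R, is_derive x 1 w (w1 x);
  smooth_derive2 : forall x : R, is_derive x 1 w1 (w2 x);
  smooth_derive3 : forall x : R, is_derive x 1 w2 (w3 x);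
  smooth_continuous3 : continuous w3;
  smooth_bound0 : forall x, `|w x| <= B;
  smooth_bound1 : forall x, `|w1 x| <= B;
  smooth_bound2 : forall x, `|w2 x| <= B;
  smooth_bound3 : forall x, `|w3 x| <= B }.

Lemma is_derive_derive1 (f df : R -> R) :
  (forall x : R, is_derive x 1 f (df x)) -> derive1 f = df.
Proof. by move=> fP; apply/funext => x; rewrite derive1E; exact: derive_val. Qed.

Lemma smooth_density_smear B w w1 w2 w3 s :
  smooth_density B w w1 w2 w3 ->
  smooth_density B (smear w s) (smear w1 s) (smear w2 s) (smear w3 s).
Proof.
case=> hw w0 d1 d2 d3 c3 b0 b1 b2 b3.
have c2 := is_derive_continuous d3.
have c1 := is_derive_continuous d2.
have c0 := is_derive_continuous d1.
split.
- exact: (prob_density_smear hw c0 b0 s).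
- by move=> x; exact: (smear_gt0 s x c0 b0 w0).
- by move=> x; exact: (is_derive_smear s x d1 c1 b0 b1).
- by move=> x; exact: (is_derive_smear s x d2 c2 b1 b2).
- by move=> x; exact: (is_derive_smear s x d3 c3 b2 b3).
- exact: (continuous_smear c3 b3).
- by move=> x; exact: smear_bound.
- by move=> x; exact: smear_bound.
- by move=> x; exact: smear_bound.
- by move=> x; exact: smear_bound.
Qed.

Section Facts.
Variables (B : R) (w w1 w2 w3 : R -> R).
Hypothesis sw : smooth_density B w w1 w2 w3.

Lemma smooth_continuous0 : continuous w.
Proof. exact: is_derive_continuous (smooth_derive1 sw). Qed.

Lemma smooth_continuous1 : continuous w1.
Proof. exact: is_derive_continuous (smooth_derive2 sw). Qed.

Lemma smooth_continuous2 : continuous w2.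
Proof. exact: is_derive_continuous (smooth_derive3 sw). Qed.

Lemma continuous_div_density (f : R -> R) :
  continuous f -> continuous (fun x => f x / w x).
Proof.
move=> cf x; apply: cvgM; first exact: cf.
by apply: cvgV; [rewrite gt_eqF ?(smooth_gt0 sw)|exact: smooth_continuous0].
Qed.

Definition density_curvature x : R :=
  w3 x / w x - 2 * (w1 x / w x) * (w2 x / w x) + (w1 x / w x) ^+ 3.

Definition fisher_moment (f : R -> R) (m : nat) : \bar R :=
  (\int[leb]_x (`|f x / w x| ^+ m * w x)%:E)%E.

Lemma fisher_moment_ge0 f m : (0 <= fisher_moment f m)%E.
Proof.
apply: integral_ge0 => x _; rewrite lee_fin mulr_ge0 ?exprn_ge0//.
exact/ltW/(smooth_gt0 sw).
Qed.

Lemma C_constE : C_const w = sqrte (3%:E * fisher_moment w3 2 +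
  12%:E * sqrte (fisher_moment w1 4) * sqrte (fisher_moment w2 4) +
  3%:E * fisher_moment w1 6)%E.
Proof.
have E1 : derive1n 1 w = w1 by exact: is_derive_derive1 (smooth_derive1 sw).
have E2 : derive1n 2 w = w2.
  by rewrite -(is_derive_derive1 (smooth_derive2 sw)) -E1.
have E3 : derive1n 3 w = w3.
  by rewrite -(is_derive_derive1 (smooth_derive3 sw)) -E2.
by rewrite /C_const E1 E2 E3.
Qed.

Lemma integral_density_moment (f : R -> R) m : continuous f ->
  (\int[density_measure (smooth_prob sw)]_x (`|f x / w x| ^+ m)%:E =
   fisher_moment f m)%E.
Proof.
move=> cf; rewrite ge0_integral_density//.
apply/measurable_EFinP/measurable_funX/measurableT_comp => //.
by apply: continuous_measurable; exact: continuous_div_density.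
Qed.

(** The numbers 3, 12, 3 come from [(x + y + z)^2 <= 3 (x^2 + y^2 + z^2)], the middle term carrying
    a factor 2; Cauchy-Schwarz then splits the mixed moment into two fourth moments. *)
Lemma density_curvature_le :
  (sqrte (\int[density_measure (smooth_prob sw)]_x (density_curvature x ^+ 2)%:E)
    <= C_const w)%E.
Proof.
set P := density_measure _.
have ge0 := fisher_moment_ge0.
rewrite C_constE lee_sqrt; last first.
  by rewrite !adde_ge0 ?mule_ge0 ?sqrte_ge0.
have mq (f : R -> R) : continuous f -> measurable_fun setT (fun x => f x / w x).
  by move=> cf; apply: continuous_measurable; exact: continuous_div_density.
have m1 := mq _ smooth_continuous1.
have m2 := mq _ smooth_continuous2.
have m3 := mq _ (smooth_continuous3 sw).
have mX (f : R -> R) m : measurable_fun setT f ->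
    measurable_fun setT (fun x => (`|f x| ^+ m)%:E).
  by move=> mf; apply/measurable_EFinP/measurable_funX/measurableT_comp.
pose q1 x := w1 x / w x; pose q2 x := w2 x / w x; pose q3 x := w3 x / w x.
have CS : (\int[P]_x (`|q1 x| ^+ 2 * `|q2 x| ^+ 2)%:E <=
    sqrte (fisher_moment w1 4) * sqrte (fisher_moment w2 4))%E.
  have := @hoelder _ _ _ P (fun x => `|q1 x| ^+ 2) (fun x => `|q2 x| ^+ 2) 2 2.
  rewrite !Lnorm2E Lnorm1.
  rewrite -!(integral_density_moment _ smooth_continuous1)
    -!(integral_density_moment _ smooth_continuous2).
  under eq_integral do rewrite gee0_abs ?lee_fin ?mulr_ge0 ?exprn_ge0//.
  under [in X in (_ <= X * _)%E]eq_integral do rewrite -exprM.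
  under [in X in (_ <= _ * X)%E]eq_integral do rewrite -exprM.
  apply => //.
  - apply/measurable_EFinP; exact: (mX q1 2%N m1).
  - apply/measurable_EFinP; exact: (mX q2 2%N m2).
  - by lra.
apply: (@le_trans _ _ (\int[P]_x (3%:E * (`|q3 x| ^+ 2)%:E +
    12%:E * (`|q1 x| ^+ 2 * `|q2 x| ^+ 2)%:E + 3%:E * (`|q1 x| ^+ 6)%:E))%E).
  apply: ge0_le_integral => //.
  - by move=> x _; rewrite lee_fin sqr_ge0.
  - apply/measurable_EFinP/measurable_funX; apply: measurable_funD.
      apply: measurable_funB => //; apply: measurable_funM => //.
      exact: measurable_funM.
    exact: measurable_funX.
  - apply: emeasurable_funD; first apply: emeasurable_funD.
    + by apply: emeasurable_funM => //; exact: (mX q3 _ m3).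
    + apply: emeasurable_funM => //; apply/measurable_EFinP/measurable_funM.
        apply/measurable_EFinP; exact: (mX q1 _ m1).
      apply/measurable_EFinP; exact: (mX q2 _ m2).
    + by apply: emeasurable_funM => //; exact: (mX q1 _ m1).
  - move=> x _; rewrite -!EFinM -!EFinD lee_fin /density_curvature -/(q1 x) -/(q2 x) -/(q3 x).
    rewrite (_ : `|q1 x| ^+ 6 = (`|q1 x| ^+ 2) ^+ 3); last by rewrite -exprM.
    rewrite !real_normK ?num_real//.
    move: (q1 x) (q2 x) (q3 x) => a b c; rewrite -subr_ge0.
    (* The gap in the inequality for three squares is the sum of the squared pairwise differences of
       [c], [- 2 a b] and [a^3]. *)
    rewrite (_ : _ - _ = (c + 2 * a * b) ^+ 2 + (c - a ^+ 3) ^+ 2 +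
      (2 * a * b + a ^+ 3) ^+ 2); last by ring.
    by rewrite !addr_ge0 ?sqr_ge0.
have mE (f : R -> R) m : measurable_fun setT f ->
    measurable_fun setT (fun x => (3%:E * (`|f x| ^+ m)%:E)%E).
  by move=> mf; apply: emeasurable_funM => //; exact: mX.
have m12 : measurable_fun setT (fun x => (`|q1 x| ^+ 2 * `|q2 x| ^+ 2)%:E).
  apply/measurable_EFinP/measurable_funM; apply/measurable_EFinP.
    exact: (mX q1 _ m1).
  exact: (mX q2 _ m2).
have p12 x : (0 <= (`|q1 x| ^+ 2 * `|q2 x| ^+ 2)%:E)%E.
  by rewrite lee_fin mulr_ge0 ?exprn_ge0.
have pX (f : R -> R) m : forall x : R, [set: R] x ->
    (0 <= 3%:E * (`|f x| ^+ m)%:E)%E.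
  by move=> x _; rewrite mule_ge0 ?lee_fin ?exprn_ge0.
have p12' (x : R) : [set: R] x ->
    (0 <= 12%:E * (`|q1 x| ^+ 2 * `|q2 x| ^+ 2)%:E)%E.
  by move=> _; rewrite mule_ge0.
have m12' : measurable_fun setT
    (fun x => 12%:E * (`|q1 x| ^+ 2 * `|q2 x| ^+ 2)%:E)%E.
  exact: emeasurable_funM.
rewrite [leLHS](_ : _ = \int[P]_x (3%:E * (`|q3 x| ^+ 2)%:E) +
    \int[P]_x (12%:E * (`|q1 x| ^+ 2 * `|q2 x| ^+ 2)%:E) +
    \int[P]_x (3%:E * (`|q1 x| ^+ 6)%:E))%E; last first.
  transitivity (\int[P]_x (3%:E * (`|q3 x| ^+ 2)%:E +
      12%:E * (`|q1 x| ^+ 2 * `|q2 x| ^+ 2)%:E) +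
      \int[P]_x (3%:E * (`|q1 x| ^+ 6)%:E))%E.
    apply: ge0_integralD; first exact: measurableT.
    - by move=> x xT; apply: adde_ge0; [exact: (pX q3 2%N)|exact: p12'].
    - by apply: emeasurable_funD => //; exact: (mE q3 2%N m3).
    - exact: (pX q1 6%N).
    - exact: (mE q1 6%N m1).
  congr (_ + _)%E; apply: ge0_integralD; first exact: measurableT.
  - exact: (pX q3 2%N).
  - exact: (mE q3 2%N m3).
  - exact: p12'.
  - exact: m12'.
have mX6 := mX q1 6%N m1; have mX2 := mX q3 2%N m3.
rewrite !ge0_integralZl//.
rewrite (integral_density_moment 2 (smooth_continuous3 sw)).
rewrite (integral_density_moment 6 smooth_continuous1).
by rewrite leeD2r// leeD2l// -muleA lee_pmul2l.
Qed.

(** Finiteness of [C_const] gives a finite sixth moment of [w1 / w], and [y <= 1 + y^3] with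
    [y = (w1 / w)^2] passes to the second. This is what puts the velocity of the CDT in
    [L^2(dr)]. *)
Lemma fisher_information_lty : (C_const w < +oo)%E ->
  (\int[density_measure (smooth_prob sw)]_x ((w1 x / w x) ^+ 2)%:E < +oo)%E.
Proof.
have ge0 := fisher_moment_ge0; set P := density_measure _.
rewrite C_constE => Clty.
have m6 : (fisher_moment w1 6 < +oo)%E.
  rewrite ltNge leye_eq; apply/negP => /eqP m6y.
  move: Clty; rewrite m6y gt0_muley ?lte_fin//.
  set S := (_ + _ * _)%E; have S0 : (0 <= S)%E.
    by rewrite adde_ge0 ?mule_ge0 ?sqrte_ge0.
  by rewrite addey//; apply/eqP => Sy; move: S0; rewrite Sy.
have m1 : measurable_fun setT (fun x => w1 x / w x).
  by apply: continuous_measurable; apply: continuous_div_density;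
    exact: smooth_continuous1.
apply: (@le_lt_trans _ _ (\int[P]_x (1 + (`|w1 x / w x| ^+ 6)%:E))%E).
  apply: ge0_le_integral => //.
  - by move=> x _; rewrite lee_fin sqr_ge0.
  - exact/measurable_EFinP/measurable_funX.
  - apply: emeasurable_funD => //.
    by apply/measurable_EFinP/measurable_funX/measurableT_comp.
  - move=> x _; rewrite -EFinD lee_fin.
    rewrite (_ : `|_| ^+ 6 = (`|w1 x / w x| ^+ 2) ^+ 3); last by rewrite -exprM.
    rewrite real_normK ?num_real//.
    have := sqr_ge0 (w1 x / w x); move: (_ ^+ 2) => y y0.
    have [y1|y1] := leP y 1; first by rewrite (le_trans y1)// lerDl exprn_ge0.
    by apply: (@le_trans _ _ (y ^+ 3)); rewrite ?lerDr// ler_eXnr// ltW.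
have mX : measurable_fun setT (fun x => (`|w1 x / w x| ^+ 6)%:E).
  by apply/measurable_EFinP/measurable_funX/measurableT_comp.
rewrite ge0_integralD//.
rewrite integral_cst//= probability_setT mul1e.
rewrite (integral_density_moment 6 smooth_continuous1).
by rewrite lte_add_pinfty// ltry.
Qed.

End Facts.

Lemma C_const_smear_le B w w1 w2 w3 s :
  smooth_density B w w1 w2 w3 -> (C_const (smear w s) <= C_const w)%E.
Proof.
move=> sw; have sws := smooth_density_smear s sw.
have ge0 := fisher_moment_ge0 sw; have ge0s := fisher_moment_ge0 sws.
have c0 := smooth_continuous0 sw; have c1 := smooth_continuous1 sw.
have c2 := smooth_continuous2 sw; have c3 := smooth_continuous3 sw.
case: (sw) => hw w0 d1 d2 d3 _ b0 b1 b2 b3.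
rewrite (C_constE sw) (C_constE sws) lee_sqrt; last first.
  by rewrite !adde_ge0 ?mule_ge0 ?sqrte_ge0.
have h3 : (fisher_moment (smear w s) (smear w3 s) 2 <= fisher_moment w w3 2)%E.
  by apply: (@integral_ratio_smear_le _ w B) => //; exact: tangent_pow2.
have h1 : (fisher_moment (smear w s) (smear w1 s) 4 <= fisher_moment w w1 4)%E.
  by apply: (@integral_ratio_smear_le _ w B) => //; exact: tangent_pow4.
have h2 : (fisher_moment (smear w s) (smear w2 s) 4 <= fisher_moment w w2 4)%E.
  by apply: (@integral_ratio_smear_le _ w B) => //; exact: tangent_pow4.
have h6 : (fisher_moment (smear w s) (smear w1 s) 6 <= fisher_moment w w1 6)%E.
  by apply: (@integral_ratio_smear_le _ w B) => //; exact: tangent_pow6.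
rewrite !leeD ?lee_pmul2l// -!muleA lee_pmul2l//.
by apply: lee_pmul; rewrite ?sqrte_ge0 ?lee_sqrt.
Qed.

End SmoothDensity.

(** * Distribution functions and transport *)

(** The open right half-lines are closed under intersection and generate the Borel sets; on them
    both probabilities are complements of the given values. *)
Lemma eq_probability_cdf (R : realType) (P Q : probability (measurableTypeR R) R) :
  (forall x, P `]-oo, x]%classic = Q `]-oo, x]%classic) ->
  forall A, measurable A -> P A = Q A.
Proof.
move=> PQ; apply: (@measure_unique _ R (measurableTypeR R) (@RGenOInfty.G R)
  (fun n => `](- n%:R), +oo[%classic) (RGenOInfty.measurableE R)).
- move=> _ _ [x ->] [y ->]; exists (Num.max x y).
  by apply/seteqP; split => z /=; rewrite !in_itv/= !andbT gt_max;
    [move=> [-> ->]|move=> /andP[]].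
- by move=> n; exists (- n%:R).
- rewrite -subTset => x _; have /filter_ex[n xn] := nbhs_infty_gtr (- x).
  by exists n => //=; rewrite in_itv/= andbT ltrNl.
- move=> _ [x ->].
  rewrite (_ : `]x, +oo[%classic = ~` `]-oo, x]%classic); last by rewrite setCitvl.
  have mx : measurable (`]-oo, x]%classic : set (measurableTypeR R)) by [].
  by transitivity (1 - P `]-oo, x]%classic)%E; [exact: probability_setC|
    rewrite PQ; apply/esym; exact: probability_setC].
- by move=> n; rewrite (le_lt_trans (probability_le1 _ _)) ?ltry.
Qed.

Section Cumulative.
Context (R : realType) (w : R -> R).
Local Notation leb := (@lebesgue_measure R).
Hypotheses (hw : prob_density w) (w_gt0 : forall x, 0 < w x).

Lemma density_integrable (A : set R) :
  measurable A -> leb.-integrable A (EFin \o w).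
Proof.
move=> mA; apply: (integrableS measurableT) => //.
have [mw w0 w1] := hw; apply/integrableP; split; first exact/measurable_EFinP.
by under eq_integral do rewrite gee0_abs ?lee_fin//; rewrite w1 ltry.
Qed.

Lemma cumulative_EFin x :
  (cumulative w x)%:E = density_measure hw `]-oo, x]%classic.
Proof.
rewrite /cumulative /Rintegral fineK//.
exact: (fin_num_measure (density_measure hw)).
Qed.

Lemma cumulative_le x y : x <= y -> cumulative w x <= cumulative w y.
Proof.
move=> xy; rewrite -lee_fin !cumulative_EFin; apply: le_measure; rewrite ?inE//.
by move=> z /=; rewrite !in_itv/= => /le_trans; apply.
Qed.

(** Equality would give []x, y]] mass zero, so the positive [w] would vanish almost everywhere on an
    interval of positive length. *)
Lemma cumulative_lt x y : x < y -> cumulative w x < cumulative w y.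
Proof.
move=> xy; rewrite lt_neqAle cumulative_le ?(ltW xy)// andbT.
apply/negP => /eqP Fxy.
have [mw w0 w1] := hw.
have E : density_measure hw `]x, y]%classic = 0%E.
  have : density_measure hw `]-oo, y]%classic =
      (density_measure hw `]-oo, x]%classic + density_measure hw `]x, y]%classic)%E.
    rewrite -measureU//.
      congr (density_measure hw _); apply/seteqP; split => z /=; rewrite !in_itv/=.
        by move=> zy; case: (leP z x) => zx; [left|right].
      by move=> [/le_trans|/andP[]//]; apply; exact: ltW.
    by apply/seteqP; split => // z /= []; rewrite !in_itv/= leNgt => /negP zx /andP[].
  have /fineK <- : density_measure hw `]x, y]%classic \is a fin_num.
    exact: (fin_num_measure (density_measure hw)).
  rewrite -!cumulative_EFin Fxy -EFinD => -[] /eqP.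
  by rewrite -[X in X == _]addr0 (inj_eq (addrI _)) => /eqP <-.
have mwE : measurable_fun `]x, y] (EFin \o w).
  by apply: measurable_funTS; exact/measurable_EFinP.
have E' : (\int[leb]_(z in `]x, y]) `|(w z)%:E| = 0)%E.
  by under eq_integral do rewrite gee0_abs ?lee_fin//.
have [A [mA A0 subA]] := (ae_eq_integral_abs leb (measurable_itv _) mwE).1 E'.
have : leb `]x, y]%classic = 0%E.
  apply/eqP; rewrite -measure_le0 -A0 le_measure ?inE//.
  move=> z zxy; apply: subA => /= /(_ zxy) [] wz0.
  by move: (w_gt0 z); rewrite wz0 ltxx.
rewrite lebesgue_measure_itv/= lte_fin xy -EFinD => -[] /eqP.
by rewrite subr_eq0 gt_eqF.
Qed.

Lemma cumulative_leE x y : (cumulative w x <= cumulative w y) = (x <= y).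
Proof.
apply/idP/idP; last exact: cumulative_le.
by apply: contraTT; rewrite -!ltNge; exact: cumulative_lt.
Qed.

Lemma cumulative_gt0 x : 0 < cumulative w x.
Proof.
apply: (@le_lt_trans _ _ (cumulative w (x - 1))).
  by rewrite -lee_fin cumulative_EFin measure_ge0.
by apply: cumulative_lt; rewrite ltrBlDr ltrDl.
Qed.

Lemma cumulative_lt1 x : cumulative w x < 1.
Proof.
apply: (@lt_le_trans _ _ (cumulative w (x + 1))).
  by apply: cumulative_lt; rewrite ltrDl.
by rewrite -lee_fin cumulative_EFin; exact: probability_le1.
Qed.

Lemma continuous_cumulative : continuous (cumulative w).
Proof.
move=> x.
have int (A : set R) := @density_integrable A.
have x1 : x - 1 < x + 1 by lra.
(* The half-line is cut at [x - 1], which leaves an indefinite integral over a compact interval. *)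
have : {within `[x - 1, x + 1], continuous
    (fun y => cumulative w (x - 1) + \int[leb]_(t in `[x - 1, y]) w t)}.
  move=> y; apply: cvgD; first exact: cvg_cst.
  exact: (@parameterized_integral_continuous _ (x - 1) (x + 1) w (ltW x1)
    (int _ (measurable_itv _))).
have xI : x \in `]x - 1, x + 1[ by rewrite in_itv/=; apply/andP; split; lra.
move=> /(continuous_within_itvP _ x1)[/(_ x xI) cx _ _]; rewrite /continuous_at in cx.
have E y : x - 1 < y -> cumulative w (x - 1) + \int[leb]_(t in `[x - 1, y]) w t =
    cumulative w y.
  move=> xy; have := @Rintegral_itvB _ w -oo%O (BRight y) (x - 1)
    (int _ (measurable_itv _)).
  rewrite bnd_simp => /(_ isT); rewrite bnd_simp => /(_ (ltW xy)).
  rewrite Rintegral_itv_obnd_cbnd; last exact: int.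
  by move=> <-; rewrite addrC subrK.
have xx : x - 1 < x by lra.
rewrite (E x xx) in cx; apply: cvg_trans cx.
apply: near_eq_cvg; near=> y; apply: E.
by near: y; exact: lt_nbhsr.
Unshelve. all: by end_near. Qed.

Lemma cumulative_surj p : 0 < p < 1 -> exists x, cumulative w x = p.
Proof.
move=> /andP[p0 p1].
have mid : @measurable_fun _ _ (measurableTypeR R) R setT idfun.
  exact: measurable_id.
(* The identity, seen as a random variable under the density measure, has [cumulative w] as
   distribution function; its limits 0 and 1 give the endpoints for the intermediate value
   theorem. *)
pose X : {mfun measurableTypeR R >-> R} :=
  @mfun_Sub _ _ (measurableTypeR R) R idfun (mem_set mid).
have cE x : cdf (P := density_measure hw) X x = (cumulative w x)%:E.
  by rewrite cumulative_EFin.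
have [b pb] : exists b, p < cumulative w b.
  have PF : ProperFilter (pinfty_nbhs R) by exact: proper_pinfty_nbhs.
  have FF : Filter (pinfty_nbhs R) by case: PF.
  have H := fine_cvg (cvg_cdfy1 (P := density_measure hw) X).
  have [b] := @filter_ex _ _ PF _ (@cvgr_gt R R (pinfty_nbhs R) FF _ 1 (H FF) p p1).
  by move=> pb; exists b; rewrite -[cumulative w b]/(fine (cumulative w b)%:E) -cE.
have [a ap] : exists a, cumulative w a < p.
  have PF : ProperFilter (ninfty_nbhs R) by exact: proper_ninfty_nbhs.
  have FF : Filter (ninfty_nbhs R) by case: PF.
  have H := fine_cvg (cvg_cdfNy0 (P := density_measure hw) X).
  have [a] := @filter_ex _ _ PF _ (@cvgr_lt R R (ninfty_nbhs R) FF _ 0 (H FF) p p0).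
  by move=> ap; exists a; rewrite -[cumulative w a]/(fine (cumulative w a)%:E) -cE.
have ab : a <= b by rewrite -cumulative_leE ltW// (lt_trans ap).
have [||c _ <-] := @IVT _ (cumulative w) a b p ab.
- by apply: continuous_subspaceT; exact: continuous_cumulative.
- by rewrite ge_min le_max (ltW ap) (ltW pb) orbT.
- by exists c.
Qed.

Lemma quantile_cumulative x : quantile w (cumulative w x) = x.
Proof.
rewrite /quantile (_ : [set _ | _] = `[x, +oo[%classic).
  by rewrite inf_itv.
by apply/seteqP; split => y /=; rewrite in_itv/= andbT cumulative_leE.
Qed.

Lemma is_derive_cumulative : continuous w ->
  forall x : R, is_derive x 1 (cumulative w) (w x).
Proof.
move=> cw x.
have [dF F'] := @continuous_FTC1 _ w -oo%O x (x + 1) ltac:(by rewrite ltrDl)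
  (@density_integrable _ (measurable_itv _)) (ltNyr x) (cw x).
by apply: DeriveDef => //; rewrite -derive1E.
Qed.

End Cumulative.

Section Transport.
Context (R : realType) (r v : R -> R).
Hypotheses (hr : prob_density r) (r_gt0 : forall x, 0 < r x).
Hypotheses (hv : prob_density v) (v_gt0 : forall x, 0 < v x).

Lemma cumulative_cdt xi : cumulative v (cdt r v xi) = cumulative r xi.
Proof.
have [x vx] : exists x, cumulative v x = cumulative r xi.
  by apply: (cumulative_surj hv v_gt0); rewrite (cumulative_gt0 hr) ?(cumulative_lt1 hr).
by rewrite /cdt -vx quantile_cumulative.
Qed.

Lemma cdt_leE xi eta : (cdt r v xi <= cdt r v eta) = (xi <= eta).
Proof.
by rewrite -(cumulative_leE hv v_gt0) !cumulative_cdt (cumulative_leE hr r_gt0).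
Qed.

Lemma measurable_cdt : measurable_fun setT (cdt r v).
Proof.
apply: nondecreasing_measurable => // x y xy.
by rewrite cdt_leE.
Qed.

(** The CDT pushes [r dxi] forward to [v dx]. It suffices to compare half-lines: the preimage of
    []-oo, x]] is []-oo, eta]], where [eta] is chosen with [F_r(eta) = F_v(x)]. *)
Lemma ge0_integral_cdt (f : R -> \bar R) :
  measurable_fun setT f -> (forall x, 0 <= f x)%E ->
  (\int[density_measure hr]_xi f (cdt r v xi) = \int[density_measure hv]_x f x)%E.
Proof.
move=> mf f0.
pose X : {mfun measurableTypeR R >-> measurableTypeR R} :=
  @mfun_Sub _ _ (measurableTypeR R) (measurableTypeR R) (cdt r v)
    (mem_set measurable_cdt).
have := @ge0_integral_distribution _ _ _ _ _ (density_measure hr) X f mf f0.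
rewrite /= => <-; apply: eq_measure_integral => A mA _.
apply: eq_probability_cdf => // x.
have [eta Feta] : exists eta, cumulative r eta = cumulative v x.
  by apply: (cumulative_surj hr r_gt0); rewrite (cumulative_gt0 hv) ?(cumulative_lt1 hv).
transitivity (cumulative v x)%:E; last exact: cumulative_EFin.
rewrite -Feta (cumulative_EFin hr).
congr (density_measure hr _); apply/seteqP; split => xi /=; rewrite !in_itv/=.
  by rewrite -(cumulative_leE hv v_gt0) cumulative_cdt -Feta (cumulative_leE hr r_gt0).
by rewrite -(cumulative_leE hv v_gt0 (cdt r v xi)) cumulative_cdt -Feta
  (cumulative_leE hr r_gt0).
Qed.

End Transport.

(** * Quantile curves and their Taylor expansion *)

Lemma is_derive_cvgP (R : realType) (f : R -> R) (x d : R) :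
  is_derive x 1 f d <-> h^-1 * (f (h + x) - f x) @[h --> 0^'] --> d.
Proof.
split=> [[df <-]|df].
  move: df; rewrite /derivable /derive; under eq_fun do rewrite /= scaler1.
  exact.
have E : (fun h => h^-1 *: ((f \o shift x) (h *: 1) - f x)) @ 0^' --> d.
  by under eq_fun do rewrite /= scaler1.
apply: DeriveDef; first by apply/cvg_ex; exists d.
exact: cvg_lim E.
Qed.

(** Compactness makes the local estimate uniform. The point [x + h] may leave the segment, hence
    continuity on the whole line. *)
Lemma uniformly_continuous_segment (R : realType) (f : R -> R) (a b e : R) :
  continuous f -> 0 < e ->
  \forall h \near 0, forall x, a <= x <= b -> `|f x - f (x + h)| <= e.
Proof.
move=> cf e0.
suff H : forall x, `[a, b]%classic x ->
    \forall y \near x & h \near 0, `|f y - f (y + h)| <= e.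
  have := (compact_near_coveringP _).1 (@segment_compact R a b) R (nbhs (0 : R))
    (fun h x => `|f x - f (x + h)| <= e) (nbhs_filter _) H.
  by apply: filterS => h {}H x xab; apply: H; rewrite /= in_itv.
move=> x _.
have e20 : 0 < e / 2 by rewrite divr_gt0.
have /cvgrPdist_lt/(_ _ e20)[d /= d0 dP] := cf x.
exists (ball x (d / 2), ball 0 (d / 2)); first split.
- by exists (d / 2) => //=; rewrite divr_gt0.
- by exists (d / 2) => //=; rewrite divr_gt0.
move=> [y h] [/= xy h0].
have fy : `|f x - f y| < e / 2.
  by apply: dP => /=; rewrite (lt_trans xy)// ltr_pdivrMr// ltr_pMr// ltrDl.
have fyh : `|f x - f (y + h)| < e / 2.
  apply: dP => /=; move: xy h0; rewrite /ball/= sub0r normrN => xy h0.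
  rewrite opprD addrA (le_lt_trans (ler_normB _ _))//; lra.
rewrite -[f y](subrK (f x)) -addrA.
rewrite (le_trans (ler_normD _ _))// distrC.
lra.
Qed.

(** Telescope [f S - f 0] over the cells and apply the mean value theorem in each; uniform
    continuity of [df] compares the intermediate point with the left endpoint. *)
Lemma riemann_sum_cvg (R : realType) (f df : R -> R) (S : R) : 0 <= S ->
  (forall x : R, is_derive x 1 f (df x)) -> continuous df ->
  \sum_(0 <= k < n.+1) df (k%:R * (S / n.+1%:R)) * (S / n.+1%:R) @[n --> \oo]
    --> f S - f 0.
Proof.
move=> S0 fP cdf; apply/cvgrPdist_le => e e0.
(* Dividing by [S + 1] instead of [S] covers [S = 0]. *)
have e1 : 0 < e / (S + 1) by rewrite divr_gt0// ltr_wpDl.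
have [d /= d0 dP] := uniformly_continuous_segment 0 S cdf e1.
have := @cvg_harmonic R => /cvgr0Pnorm_lt/(_ (d / (S + 1))).
rewrite divr_gt0 ?ltr_wpDl// => /(_ isT); apply: filterS => n /=.
rewrite /harmonic ger0_norm ?invr_ge0// => nd.
pose D := S / n.+1%:R; rewrite -/D.
have D0 : 0 <= D by rewrite divr_ge0.
have Dd : D < d.
  rewrite /D mulrC; apply: le_lt_trans (_ : n.+1%:R^-1 * (S + 1) < _).
    by rewrite ler_wpM2l ?invr_ge0// lerDl.
  by rewrite -ltr_pdivlMr// ltr_wpDl.
have SE : S = n.+1%:R * D by rewrite /D mulrC divfK.
have -> : f S - f 0 = \sum_(0 <= k < n.+1) (f (k.+1%:R * D) - f (k%:R * D)).
  by rewrite telescope_sumr// mul0r -SE.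
rewrite -sumrB (le_trans (ler_norm_sum _ _ _))//.
have term k : (0 <= k < n.+1)%N ->
    `|f (k.+1%:R * D) - f (k%:R * D) - df (k%:R * D) * D| <= e / (S + 1) * D.
  move=> /andP[_ kn].
  have kk : k%:R * D <= k.+1%:R * D by rewrite ler_wpM2r// ler_nat.
  have kS : k.+1%:R * D <= S by rewrite SE ler_wpM2r// ler_nat.
  have k0 : 0 <= k%:R * D by rewrite mulr_ge0.
  have [c] := @MVT_segment _ f df _ _ kk (fun z _ => fP z)
    (continuous_subspaceT (is_derive_continuous fP)).
  rewrite in_itv/= => /andP[c1 c2] ->.
  rewrite (_ : k.+1%:R * D - k%:R * D = D); last first.
    by rewrite -mulrBl -natrB// subSnn mul1r.
  rewrite -mulrBl normrM (ger0_norm D0) ler_wpM2r//.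
  rewrite distrC -[in X in _ - X](subrK (k%:R * D) c) addrC [_ + k%:R * D]addrC addrC.
  apply: dP => /=; last first.
    by rewrite k0 (le_trans kk).
  rewrite sub0r normrN ger0_norm ?subr_ge0// (le_lt_trans _ Dd)//.
  by rewrite lerBlDl (le_trans c2)// -natr1 mulrDl mul1r.
rewrite (le_trans (_ : _ <= \sum_(0 <= k < n.+1) e / (S + 1) * D))//.
  by rewrite !big_nat; apply: ler_sum => k kn; exact: term.
rewrite sumr_const_nat subn0 -[leLHS]mulr_natl mulrCA -SE.
by rewrite mulrAC ler_pdivrMr ?ltr_wpDl// ler_pM2l// lerDl.
Qed.

(** Equal derivatives leave a constant difference [k = f - g]. If [k] were negative, a point with
    [f = 1 + k / 2] would have [g > 1]; if positive, a point with [f = k / 2] would have [g < 0]. *)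
Lemma eq_distribution_function (R : realType) (f g d : R -> R) :
  (forall x : R, is_derive x 1 f (d x)) -> (forall x : R, is_derive x 1 g (d x)) ->
  (forall x, 0 < f x < 1) -> (forall p, 0 < p < 1 -> exists x, f x = p) ->
  (forall x, 0 <= g x <= 1) -> f =1 g.
Proof.
move=> fP gP f01 fsurj g01 x.
have D (y : R) : is_derive y 1 (fun t => f t - g t) 0.
  by apply: (is_derive_eq (derive_add_rule (fP y) (derive_opp_rule (gP y))));
    rewrite subrr.
have K y : f y - g y = f x - g x.
  exact: (@is_derive_0_is_cst _ (fun t => f t - g t)).
set k := (f x - g x) in K.
apply/eqP; rewrite -subr_eq0 -/k; apply/eqP.
have klt1 : k < 1 by have /andP[] := f01 x; have /andP[] := g01 x; rewrite /k; lra.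
have kgt1 : -1 < k by have /andP[] := f01 x; have /andP[] := g01 x; rewrite /k; lra.
have [k0|k0|//] := ltgtP k 0.
- have [|y fy] := fsurj (1 + k / 2); first by apply/andP; split; lra.
  by have := K y; have /andP[] := g01 y; lra.
- have [|y fy] := fsurj (k / 2); first by apply/andP; split; lra.
  by have := K y; have /andP[] := g01 y; lra.
Qed.

Section QuantileCurve.
Context (R : realType).
Variables (B : R) (w w1 w2 w3 : R -> R).
Hypothesis sw : smooth_density B w w1 w2 w3.

Let F := cumulative w.
Let hw := smooth_prob sw.
Let w_gt0 := smooth_gt0 sw.
Let c0 := smooth_continuous0 sw.
Let c1 := smooth_continuous1 sw.
Let c2 := smooth_continuous2 sw.
Let c3 := smooth_continuous3 sw.
Let b0 := smooth_bound0 sw.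
Let b1 := smooth_bound1 sw.
Let b2 := smooth_bound2 sw.
Let b3 := smooth_bound3 sw.

Let dF : forall x : R, is_derive x 1 F (w x).
Proof. exact: is_derive_cumulative. Qed.

Let cF : continuous F.
Proof. exact: is_derive_continuous dF. Qed.

Let FB x : `|F x| <= 1.
Proof.
by rewrite ger0_norm ltW// ?(cumulative_gt0 hw)// (cumulative_lt1 hw).
Qed.

(** Both sides have derivative [smear w s], and both stay within the range of a distribution
    function. The dependence on [s] thus becomes a Gaussian average of the fixed function [F]. *)
Lemma cumulative_smear s x : cumulative (smear w s) x = smear F s x.
Proof.
have sws := smooth_density_smear s sw.
have hs := smooth_prob sws; have s_gt0 := smooth_gt0 sws.
have dFs := is_derive_cumulative hs (smooth_continuous0 sws).
have FB' y : `|F y| <= B + 1.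
  by rewrite (le_trans (FB y))// lerDr (le_trans _ (b0 0)).
have wB' y : `|w y| <= B + 1 by rewrite (le_trans (b0 y))// lerDl.
have F0 y : 0 < smear F s y.
  by apply: (smear_gt0 s y cF FB) => z; exact: cumulative_gt0.
have F1 y : smear F s y <= 1.
  by rewrite (le_trans (ler_norm _))// (smear_bound s y cF FB).
apply: (eq_distribution_function dFs (fun y => is_derive_smear s y dF c0 FB' wB')).
- by move=> y; rewrite (cumulative_gt0 hs s_gt0) (cumulative_lt1 hs s_gt0).
- exact: cumulative_surj.
- by move=> y; rewrite (ltW (F0 y)) F1.
Qed.

Variable p : R.
Hypothesis p01 : 0 < p < 1.

(** With [p = cumulative r xi] this is the CDT of [smear w s] at [xi], followed in [s]. *)
Definition quantile_curve s : R := quantile (smear w s) p.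
Local Notation Z := quantile_curve.

Lemma smear_quantile_curve s : smear F s (Z s) = p.
Proof.
have sws := smooth_density_smear s sw.
have [x px] := cumulative_surj (smooth_prob sws) (smooth_gt0 sws) p01.
rewrite -cumulative_smear /quantile_curve -[in quantile _ _]px.
by rewrite (quantile_cumulative (smooth_prob sws) (smooth_gt0 sws)).
Qed.

Lemma smear_cumulative_lt s x y : (smear F s x < smear F s y) = (x < y).
Proof.
have sws := smooth_density_smear s sw.
rewrite -!cumulative_smear !ltNge.
by rewrite (cumulative_leE (smooth_prob sws) (smooth_gt0 sws)).
Qed.

Let cFs x : continuous (fun s => smear F s x).
Proof. by apply: (continuous_smear_curve cF FB) => s; exact: cvg_cst. Qed.

(** The strict inequalities of [smear F] with [p] at [Z s - e] and [Z s + e] persist for nearby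
    widths, and monotonicity in space traps [Z t] between the two points. *)
Lemma continuous_quantile_curve : continuous Z.
Proof.
move=> s; apply/cvgrPdist_lt => e e0.
have lo : smear F s (Z s - e) < p.
  by rewrite -[ltRHS](smear_quantile_curve s) smear_cumulative_lt ltrBlDr ltrDl.
have hi : p < smear F s (Z s + e).
  by rewrite -[ltLHS](smear_quantile_curve s) smear_cumulative_lt ltrDl.
have H1 : \forall t \near s, smear F t (Z s - e) < p.
  exact: (cvgr_lt _ (@cFs (Z s - e) s) _ lo).
have H2 : \forall t \near s, p < smear F t (Z s + e).
  exact: (cvgr_gt _ (@cFs (Z s + e) s) _ hi).
apply: filterS2 H1 H2 => t lot hit.
have h1 : Z s - e < Z t by rewrite -(smear_cumulative_lt t) smear_quantile_curve.
have h2 : Z t < Z s + e by rewrite -(smear_cumulative_lt t) smear_quantile_curve.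
by rewrite distrC ltr_distl h1 h2.
Qed.

Let score s := smear w1 s (Z s) / smear w s (Z s).

Let N1_gt0 s : 0 < smear w s (Z s).
Proof. exact: (smear_gt0 s (Z s) c0 b0 w_gt0). Qed.

Let cw s : {for s, continuous (fun t => smear w t (Z t))}.
Proof. exact: (continuous_smear_curve c0 b0 continuous_quantile_curve). Qed.

Lemma continuous_score : continuous score.
Proof.
move=> s; apply: cvgM.
  exact: (continuous_smear_curve c1 b1 continuous_quantile_curve).
by apply: cvgV; [rewrite gt_eqF|exact: cw].
Qed.

(** The divided difference of [smear F s] in space, with an error estimate that is uniform in [s]:
    the mean value theorem is applied once to [smear F s] and once to [smear w s]. *)
Let lip s x y : exists2 m, smear F s x - smear F s y = m * (x - y) &
  0 < m /\ `|m - smear w s x| <= B * `|x - y|.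
Proof.
have FB' z : `|F z| <= B + 1.
  by rewrite (le_trans (FB z))// lerDr (le_trans _ (b0 0)).
have wB' z : `|w z| <= B + 1 by rewrite (le_trans (b0 z))// lerDl.
have dFs (z : R) := is_derive_smear s z dF c0 FB' wB'.
have dws (z : R) := is_derive_smear s z (smooth_derive1 sw) c1 b0 b1.
have cFs' := continuous_smear (s := s) cF FB.
have cws := continuous_smear (s := s) c0 b0.
have mvt (g dg : R -> R) a b : (forall z : R, is_derive z 1 g (dg z)) -> continuous g ->
    a <= b -> exists2 c, a <= c <= b & g b - g a = dg c * (b - a).
  move=> dgP cg ab.
  have [c cab ->] := @MVT_segment _ g dg a b ab (fun z _ => dgP z)
    (continuous_subspaceT cg).
  by exists c => //; move: cab; rewrite in_itv.
have mvt' (g dg : R -> R) a b : (forall z : R, is_derive z 1 g (dg z)) -> continuous g ->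
    exists2 c, `|c - a| <= `|a - b| & g a - g b = dg c * (a - b).
  move=> dgP cg; have [ab|/ltW ba] := leP a b.
    have [c /andP[ca cb] E] := mvt g dg a b dgP cg ab; exists c; last by lra.
    by rewrite [`|a - b|]distrC !ger0_norm ?subr_ge0//; lra.
  have [c /andP[cb ca] E] := mvt g dg b a dgP cg ba; exists c => //.
  by rewrite distrC !ger0_norm ?subr_ge0//; lra.
have [c cx E] := mvt' _ _ x y dFs cFs'.
exists (smear w s c) => //; split; first exact: (smear_gt0 s c c0 b0 w_gt0).
have [d _ ->] := mvt' _ _ c x dws cws.
by rewrite normrM ler_pM// (smear_bound s d c1 b1).
Qed.

(** The implicit function theorem by hand. From [F_t(Z t) = p = F_s(Z s)] one gets
    [m t * (Z t - Z s) = F_s(Z s) - F_t(Z s)]; the divided difference [m t] tends to the density,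
    and the right side varies in the width only. *)
Lemma is_derive_quantile_curve (s : R) : is_derive s 1 Z (- (2 * s * score s)).
Proof.
have [m mP mB] : exists2 m : R -> R,
    (forall t, smear F t (Z t) - smear F t (Z s) = m t * (Z t - Z s)) &
    (forall t, 0 < m t /\ `|m t - smear w t (Z t)| <= B * `|Z t - Z s|).
  have /choice[m mP] : forall t, exists m,
      smear F t (Z t) - smear F t (Z s) = m * (Z t - Z s) /\
      0 < m /\ `|m - smear w t (Z t)| <= B * `|Z t - Z s|.
    by move=> t; have [m m1 m2] := lip t (Z t) (Z s); exists m.
  by exists m => t; have [] := mP t.
have cZ := continuous_quantile_curve.
have cm : m t @[t --> s] --> smear w s (Z s).
  have h : B * `|Z t - Z s| @[t --> s] --> (0 : R).
    rewrite (_ : 0 = B * `|Z s - Z s|); last by rewrite subrr normr0 mulr0.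
    apply: cvgM; first exact: cvg_cst.
    by apply: cvg_norm; apply: cvgB; [exact: cZ|exact: cvg_cst].
  have h2 : m t - smear w t (Z t) @[t --> s] --> (0 : R).
    apply: norm_cvg0; apply: (squeeze_cvgr _ (cvg_cst 0) h).
    by apply: nearW => t; rewrite normr_ge0 /= (mB t).2.
  have -> : m = (fun t => (m t - smear w t (Z t)) + smear w t (Z t)).
    by apply/funext => t; rewrite subrK.
  by rewrite -[X in _ --> X]add0r; apply: cvgD h2 _; exact: cw.
have dFs : is_derive s 1 (fun t => smear F t (Z s)) (2 * s * smear w1 s (Z s)).
  have B1 : 0 <= B by rewrite (le_trans _ (b0 0)).
  apply: is_derive_eq.
    (* The space point is frozen at [Z s], so only the Stein term [2 s * smear w1] remains. *)
    apply: (@is_derive_smear_curve _ F w w1 (B + 1) (fun=> Z s) (fun=> 0) s) => //.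
    - exact: smooth_derive1 sw.
    - by move=> z; rewrite (le_trans (FB z))// lerDr.
    - by move=> z; rewrite (le_trans (b0 z))// lerDl.
    - by move=> z; rewrite (le_trans (b1 z))// lerDl.
    - exact: cvg_cst.
  by rewrite mul0r add0r.
apply/is_derive_cvgP; move/is_derive_cvgP : dFs => dFs.
have cmh : m (h + s) @[h --> 0^'] --> smear w s (Z s).
  have hs : h + s @[h --> 0^'] --> 0 + s.
    by apply: cvgD; [exact: cvg_within|exact: cvg_cst].
  by rewrite add0r in hs; exact: (cvg_comp (fun h => h + s) m hs cm).
have lim : - (h^-1 * (smear F (h + s) (Z s) - smear F s (Z s))) / m (h + s)
    @[h --> 0^'] --> - (2 * s * smear w1 s (Z s)) / smear w s (Z s).
  by apply: cvgM; [exact: cvgN|apply: cvgV => //; rewrite gt_eqF].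
rewrite /score mulrA -mulNr.
rewrite [X in X @ _ --> _](_ : _ =
    fun h => - (h^-1 * (smear F (h + s) (Z s) - smear F s (Z s))) / m (h + s)) //.
apply/funext => h.
have E : p - smear F (h + s) (Z s) = m (h + s) * (Z (h + s) - Z s).
  rewrite -(mP (h + s)); congr (_ - _); apply/esym.
  exact: (smear_quantile_curve (h + s)).
have mn0 : m (h + s) != 0 by rewrite gt_eqF//; have [] := mB (h + s).
have -> : smear F s (Z s) = p by exact: smear_quantile_curve.
rewrite -mulrN opprB E -mulrA.
by rewrite [m _ * _ / _]mulrAC divff// mul1r.
Qed.

(** The score is [- dZ / dtau], so this computes [- d^2 Z / dtau^2] along the curve; the factor
    [2 s] is [dtau / ds]. *)
Lemma is_derive_score (s : R) :
  is_derive s 1 score (2 * s * density_curvature (smear w s) (smear w1 s)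
    (smear w2 s) (smear w3 s) (Z s)).
Proof.
have dZ := is_derive_quantile_curve.
have cdZ : {for s, continuous (fun s : R => - (2 * s * score s) : R)}.
  apply: cvgN; apply: cvgM; last exact: continuous_score.
  by apply: cvgM; [exact: cvg_cst|exact: cvg_id].
have d1 := is_derive_smear_curve (smooth_derive2 sw) (smooth_derive3 sw)
  c3 b1 b2 b3 dZ cdZ.
have d0 := is_derive_smear_curve (smooth_derive1 sw) (smooth_derive2 sw)
  c2 b0 b1 b2 dZ cdZ.
have N0 : smear w s (Z s) != 0 by rewrite gt_eqF.
have dV := @derive_inv_rule _ (fun t => smear w t (Z t)) s _ N0 d0.
apply: (is_derive_eq (derive_mul_rule d1 dV)).
by rewrite /density_curvature /score; field.
Qed.

Definition curvature_along s : R :=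
  density_curvature (smear w s) (smear w1 s) (smear w2 s) (smear w3 s) (Z s).

Lemma continuous_curvature_along : continuous curvature_along.
Proof.
have cZ := continuous_quantile_curve.
have cq (f : R -> R) : continuous f -> (forall y, `|f y| <= B) ->
    continuous (fun s => smear f s (Z s) / smear w s (Z s)).
  move=> cf fB s; apply: cvgM; first exact: (continuous_smear_curve cf fB cZ).
  by apply: cvgV; [rewrite gt_eqF|exact: cw].
move=> s; apply: cvgD; first apply: cvgB.
- exact: (cq _ c3 b3).
- apply: cvgM; last exact: (cq _ c2 b2).
  by apply: cvgM; [exact: cvg_cst|exact: (cq _ c1 b1)].
- apply: (@continuous_comp _ _ _ (fun s => smear w1 s (Z s) / smear w s (Z s))
    (fun y => y ^+ 3)); first exact: (cq _ c1 b1).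
  exact: exprn_continuous.
Qed.

(* The Taylor remainder in the time variable [tau = s ^+ 2], as a limit of
   Riemann sums of [int_0^S 2 s (S^2 - s^2) curvature ds]. *)
Lemma quantile_taylor_remainder (S : R) : 0 <= S ->
  \sum_(0 <= k < n.+1)
    (- (2 * (k%:R * (S / n.+1%:R)) * (S ^+ 2 - (k%:R * (S / n.+1%:R)) ^+ 2)) *
      (S / n.+1%:R)) * curvature_along (k%:R * (S / n.+1%:R)) @[n --> \oo]
  --> quantile_curve S -
    (quantile_curve 0 - S ^+ 2 * (w1 (quantile_curve 0) / w (quantile_curve 0))).
Proof.
move=> S0.
(* [P s] is the first order Taylor polynomial based at [tau = s^2], evaluated at [tau = S^2]. It
   moves from the polynomial at 0 to [Z S], and first derivatives cancel in its derivative. *)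
pose P s := Z s - (S ^+ 2 - s ^+ 2) * score s.
pose dP s := - (2 * s * (S ^+ 2 - s ^+ 2)) * curvature_along s.
have PP (s : R) : is_derive s 1 P (dP s).
  apply: (is_derive_eq (derive_add_rule (is_derive_quantile_curve s)
    (derive_opp_rule (derive_mul_rule (derive_add_rule (derive_cst_rule (S ^+ 2) s)
      (derive_opp_rule (derive_exp_rule 2 (derive_id_rule s)))) (is_derive_score s))))).
  by rewrite /dP /curvature_along /=; ring.
have cdP : continuous dP.
  move=> s; apply: cvgM; last exact: continuous_curvature_along.
  apply: cvgN; apply: cvgM.
    by apply: cvgM; [exact: cvg_cst|exact: cvg_id].
  by apply: cvgB; [exact: cvg_cst|exact: exprn_continuous].
have -> : Z S - (Z 0 - S ^+ 2 * (w1 (Z 0) / w (Z 0))) = P S - P 0.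
  have -> : P S = Z S by rewrite /P subrr mul0r subr0.
  congr (_ - _); have -> : P 0 = Z 0 - S ^+ 2 * score 0.
    by rewrite /P expr0n subr0.
  by congr (_ - _ * (_ / _)); apply/esym; exact: smear0.
rewrite [X in X @ _ --> _](_ : _ = fun n => \sum_(0 <= k < n.+1)
  dP (k%:R * (S / n.+1%:R)) * (S / n.+1%:R)).
  exact: riemann_sum_cvg S0 PP cdP.
by apply/funext => n; apply: eq_bigr => k _; rewrite /dP mulrAC.
Qed.

End QuantileCurve.

Lemma limn_einf_le_lim (R : realType) (u v : (\bar R)^nat) (l : \bar R) :
  (forall n, (u n <= v n)%E) -> v @ \oo --> l -> (limn_einf u <= l)%E.
Proof.
move=> uv vl; rewrite limn_einf_lim -(cvg_lim (@ereal_hausdorff R) vl).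
apply: lee_lim; [exact: is_cvg_einfs|by apply/cvg_ex; exists l|].
apply: nearW => n; apply: le_trans (uv n).
by apply: ereal_inf_lbound; exists n => /=.
Qed.

Lemma sqr_weighted_sum_le (R : realFieldType) (n : nat) (a x : nat -> R) :
  (forall k, 0 <= a k) ->
  (\sum_(0 <= k < n) a k * x k) ^+ 2 <=
  (\sum_(0 <= k < n) a k) * (\sum_(0 <= k < n) a k * x k ^+ 2).
Proof.
move=> a0; elim: n => [|n IH]; first by rewrite !big_geq// expr0n/= mulr0.
rewrite !big_nat_recr//=; move: IH.
have : 0 <= \sum_(0 <= k < n) a k by apply: sumr_ge0.
have : 0 <= \sum_(0 <= k < n) a k * x k ^+ 2.
  by apply: sumr_ge0 => k _; rewrite mulr_ge0 ?sqr_ge0.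
move: (a n) (x n) (a0 n) (\sum_(0 <= k < n) a k) (\sum_(0 <= k < n) a k * x k)
  (\sum_(0 <= k < n) a k * x k ^+ 2) => b y b0 A s Q Q0 A0 sAQ.
(* A quadratic in [y] with discriminant at most zero, by the induction hypothesis [s^2 <= A Q]; when
   [A = 0] that hypothesis forces [s = 0]. *)
have key : 0 <= A * y ^+ 2 + Q - 2 * s * y.
  have [A0'|An0] := eqVneq A 0.
    move: sAQ; rewrite A0' !mul0r => s2.
    have /eqP : s ^+ 2 = 0 by apply/eqP; rewrite eq_le s2 sqr_ge0.
    by rewrite sqrf_eq0 => /eqP ->; rewrite mulr0 mul0r subr0 add0r.
  have Agt0 : 0 < A by rewrite lt_neqAle eq_sym An0.
  rewrite -(pmulr_rge0 _ Agt0).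
  apply: le_trans (sqr_ge0 (A * y - s)) _; rewrite -subr_ge0.
  rewrite (_ : _ - _ = A * Q - s ^+ 2); first by rewrite subr_ge0.
  by ring.
rewrite -subr_ge0 (_ : _ - _ = (A * Q - s ^+ 2) + b * (A * y ^+ 2 + Q - 2 * s * y)).
  by rewrite addr_ge0 ?subr_ge0// mulr_ge0.
by ring.
Qed.

(** * The Taylor remainder in [L^2(dr)] *)

Section L2Remainder.
Context (R : realType).
Variables (r : R -> R) (B : R) (w w1 w2 w3 : R -> R).
Hypotheses (hr : prob_density r) (r_gt0 : forall x, 0 < r x).
Hypothesis sw : smooth_density B w w1 w2 w3.
Local Notation mu := (density_measure hr).

Let K s xi := curvature_along w w1 w2 w3 (cumulative r xi) s.

Let mK s : measurable_fun setT (K s).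
Proof.
have sws := smooth_density_smear s sw.
have cq (f : R -> R) : continuous f ->
    measurable_fun setT (fun x => f x / smear w s x).
  by move=> cf; apply: continuous_measurable; exact: continuous_div_density sws _ cf.
have mcurv : measurable_fun setT (density_curvature (smear w s) (smear w1 s)
    (smear w2 s) (smear w3 s)).
  apply: measurable_funD.
    apply: measurable_funB; first exact: cq (smooth_continuous3 sws).
    apply: measurable_funM; last exact: cq (smooth_continuous2 sws).
    by apply: measurable_funM => //; exact: cq (smooth_continuous1 sws).
  by apply: measurable_funX; exact: cq (smooth_continuous1 sws).
apply: (measurableT_comp mcurv).
exact: (measurable_cdt hr r_gt0 (smooth_prob sws) (smooth_gt0 sws)).
Qed.

(** Transport by the CDT turns the left side into the curvature integral for [smear w s]; since
    smoothing does not increase [C_const], the bound is uniform in [s]. *)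
Let intK s c : C_const w = c%:E ->
  (\int[mu]_xi (K s xi ^+ 2)%:E <= (c ^+ 2)%:E)%E.
Proof.
move=> Cc; have sws := smooth_density_smear s sw.
have c0 : 0 <= c by rewrite -lee_fin -Cc; exact: sqrte_ge0.
have E : (\int[mu]_xi (K s xi ^+ 2)%:E = \int[density_measure (smooth_prob sws)]_x
  (density_curvature (smear w s) (smear w1 s) (smear w2 s) (smear w3 s) x ^+ 2)%:E)%E.
  rewrite -(@ge0_integral_cdt _ r (smear w s) hr r_gt0 (smooth_prob sws)
    (smooth_gt0 sws) (fun x => (density_curvature (smear w s) (smear w1 s)
      (smear w2 s) (smear w3 s) x ^+ 2)%:E))//.
    have cq (f : R -> R) : continuous f ->
        measurable_fun setT (fun x => f x / smear w s x).
      by move=> cf; apply: continuous_measurable; exact: continuous_div_density sws _ cf.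
    apply/measurable_EFinP/measurable_funX/measurable_funD.
      apply: measurable_funB; first exact: cq (smooth_continuous3 sws).
      apply: measurable_funM; last exact: cq (smooth_continuous2 sws).
      by apply: measurable_funM => //; exact: cq (smooth_continuous1 sws).
    by apply: measurable_funX; exact: cq (smooth_continuous1 sws).
  by move=> x; rewrite lee_fin sqr_ge0.
rewrite E -[leLHS]sqr_sqrte; last by apply: integral_ge0 => x _; rewrite lee_fin sqr_ge0.
rewrite EFin_expe lee_sqr ?sqrte_ge0 ?lee_fin// -Cc.
exact: le_trans (density_curvature_le sws) (C_const_smear_le s sw).
Qed.

Definition taylor_remainder S xi : R :=
  cdt r (smear w S) xi -
  (cdt r w xi - S ^+ 2 * (w1 (cdt r w xi) / w (cdt r w xi))).

(** Minkowski's integral inequality in discrete form: the remainder is a pointwise limit of weighted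
    sums of curvatures, each with [L^2(dr)] norm at most [c], and the total weight tends to
    [S^4 / 2]. *)
Lemma L2_taylor_remainder_le S c : 0 <= S -> C_const w = c%:E ->
  ('N[mu]_2%:E[EFin \o taylor_remainder S] <= (S ^+ 4 / 2 * c)%:E)%E.
Proof.
move=> S0 Cc.
have c0 : 0 <= c by rewrite -lee_fin -Cc; exact: sqrte_ge0.
pose x n k : R := k%:R * (S / n.+1%:R).
(* The absolute value makes the weight nonnegative for every [k]; inside the range of summation,
   where [x n k <= S], it changes nothing. *)
pose a n k : R := `|2 * x n k * (S ^+ 2 - x n k ^+ 2)| * (S / n.+1%:R).
have a0 n k : 0 <= a n k by rewrite mulr_ge0// divr_ge0.
have aE n k : (k < n.+1)%N ->
    a n k = 2 * x n k * (S ^+ 2 - x n k ^+ 2) * (S / n.+1%:R).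
  move=> kn; rewrite /a ger0_norm//.
  have x0 : 0 <= x n k by rewrite mulr_ge0// divr_ge0.
  have xS : x n k <= S.
    by rewrite /x mulrCA ler_piMr// ler_pdivrMr// mul1r ler_nat ltnW.
  by rewrite !mulr_ge0// subr_ge0 lerXn2r.
pose A n := \sum_(0 <= k < n.+1) a n k.
have A0 n : 0 <= A n by apply: sumr_ge0.
have limA : A n @[n --> \oo] --> S ^+ 4 / 2.
  have dg (t : R) : is_derive t 1 (fun t => S ^+ 2 * t ^+ 2 - 2^-1 * t ^+ 4)
      (2 * t * (S ^+ 2 - t ^+ 2)).
    have d2 := derive_exp_rule 2 (derive_id_rule t).
    have d4 := derive_exp_rule 4 (derive_id_rule t).
    apply: (is_derive_eq (derive_add_rule
      (derive_mul_rule (derive_cst_rule (S ^+ 2) t) d2)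
      (derive_opp_rule (derive_mul_rule (derive_cst_rule 2^-1 t) d4)))).
    by rewrite /=; field.
  have cdg : continuous (fun t : R => 2 * t * (S ^+ 2 - t ^+ 2)).
    move=> t; apply: cvgM; first by apply: cvgM; [exact: cvg_cst|exact: cvg_id].
    by apply: cvgB; [exact: cvg_cst|exact: exprn_continuous].
  have := riemann_sum_cvg S0 dg cdg.
  rewrite (_ : _ - _ - _ = S ^+ 4 / 2); last by field.
  rewrite [X in X @ _ --> _ -> _](_ : _ = A)//.
  by apply/funext => n; apply: eq_big_nat => k /andP[_ kn]; rewrite aE.
pose Q n xi := \sum_(0 <= k < n.+1) a n k * K (x n k) xi.
have mQ n : measurable_fun setT (Q n).
  by apply: measurable_sum => k; apply: measurable_funM => //; exact: mK.
have mQ2 n : measurable_fun setT (fun xi => (Q n xi ^+ 2)%:E).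
  by apply/measurable_EFinP; apply: measurable_funX; exact: mQ.
have mK2 s : measurable_fun setT (fun xi => (K s xi ^+ 2)%:E).
  by apply/measurable_EFinP; apply: measurable_funX; exact: mK.
have mterm n k : measurable_fun setT (fun xi => (a n k * K (x n k) xi ^+ 2)%:E).
  apply/measurable_EFinP; apply: measurable_funM => //.
  by apply: measurable_funX; exact: mK.
have limQ xi : (Q n xi) ^+ 2 @[n --> \oo] --> taylor_remainder S xi ^+ 2.
  have p01 : 0 < cumulative r xi < 1.
    by rewrite (cumulative_gt0 hr r_gt0) (cumulative_lt1 hr r_gt0).
  have lim := quantile_taylor_remainder sw p01 S0.
  have c0E : quantile_curve w (cumulative r xi) 0 = cdt r w xi.
    rewrite /quantile_curve /cdt; congr quantile.
    by apply/funext => y; exact: smear0.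
  rewrite c0E in lim.
  (* The remainder is the limit of [- Q n], as the curvature is minus the second derivative;
     squaring removes the sign. *)
  have -> : (fun n => Q n xi ^+ 2) = (fun n => (- Q n xi) ^+ 2).
    by apply/funext => n; rewrite sqrrN.
  apply: (@cvg_comp _ _ _ (fun n => - Q n xi) (fun y => y ^+ 2) _ _ _ _
    (@exprn_continuous _ 2 _)).
  apply: cvg_trans lim; apply: near_eq_cvg; apply: nearW => n.
  rewrite /Q -sumrN; apply: eq_big_nat => k /andP[_ kn].
  by rewrite aE// /K /x -!mulNr.
(* One factor [A n] comes from Cauchy-Schwarz, the other from summing the weights against the
   uniform bound [c ^+ 2]. *)
have intQ n : (\int[mu]_xi (Q n xi ^+ 2)%:E <= (A n * (A n * c ^+ 2))%:E)%E.
  apply: (@le_trans _ _ (\int[mu]_xi ((A n)%:E *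
      \sum_(0 <= k < n.+1) (a n k * K (x n k) xi ^+ 2)%:E))%E).
    apply: ge0_le_integral => //.
    - by move=> xi _; rewrite lee_fin sqr_ge0.
    - exact: mQ2.
    - by apply: emeasurable_funM => //; apply: emeasurable_sum => k; exact: mterm.
    - move=> xi _; rewrite sumEFin -EFinM lee_fin.
      exact: sqr_weighted_sum_le.
  have term0 k xi : (0 <= (a n k * K (x n k) xi ^+ 2)%:E)%E.
    by rewrite lee_fin mulr_ge0 ?sqr_ge0.
  rewrite ge0_integralZl//; last 3 first.
  - by apply: emeasurable_sum => k; exact: mterm.
  - by move=> xi _; apply: sume_ge0 => k _.
  - by rewrite lee_fin.
  rewrite [X in (_ * X)%E](ge0_integral_sum mu measurableT
    (fun k => mterm n k) (fun k xi _ => term0 k xi)) EFinM.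
  apply: lee_pmul => //; first by rewrite lee_fin.
    by apply: sume_ge0 => k _; apply: integral_ge0.
  rewrite /A mulr_suml -sumEFin; apply: lee_sum => k _.
  under eq_integral do rewrite EFinM.
  rewrite ge0_integralZl//; last 3 first.
  - exact: mK2.
  - by move=> xi _; rewrite lee_fin sqr_ge0.
  - by rewrite lee_fin.
  rewrite [leRHS]EFinM; apply: lee_pmul => //; rewrite ?lee_fin//.
    by apply: integral_ge0 => xi _; rewrite lee_fin sqr_ge0.
  exact: intK.
have key : (\int[mu]_xi (taylor_remainder S xi ^+ 2)%:E <=
    ((S ^+ 4 / 2 * c) ^+ 2)%:E)%E.
  have limE xi : limn_einf (fun n => (Q n xi ^+ 2)%:E) =
      (taylor_remainder S xi ^+ 2)%:E.
    apply: (cvg_limn_einf_sup _).1; apply: cvg_EFin; first exact: nearW.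
    exact: limQ.
  under eq_integral do rewrite -limE.
  apply: le_trans (fatou mu measurableT _ _) _.
  - exact: mQ2.
  - by move=> n xi _; rewrite lee_fin sqr_ge0.
  apply: (limn_einf_le_lim intQ); apply: cvg_EFin; first exact: nearW.
  rewrite (_ : (S ^+ 4 / 2 * c) ^+ 2 = S ^+ 4 / 2 * (S ^+ 4 / 2 * c ^+ 2)).
    by apply: cvgM => //; apply: cvgM => //; exact: cvg_cst.
  by ring.
rewrite Lnorm2E; apply: le_trans (_ : sqrte ((S ^+ 4 / 2 * c) ^+ 2)%:E <= _)%E.
  by rewrite lee_sqrt// lee_fin sqr_ge0.
rewrite EFin_expe sqrte_sqr gee0_abs// lee_fin mulr_ge0// divr_ge0// exprn_ge0//.
Qed.

End L2Remainder.

(** * Regularization by the heat kernel *)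

Section HeatKernelDerivatives.
Context (R : realType) (s : R).
Hypothesis s0 : 0 < s.
Let k : R := (2 * s)^-1.
Let G : R -> R := heat_kernel s.

(** With [k = 1 / (2 s)] one has [G' = - k x G]; the polynomial factors in this and the next two
    definitions are rescaled Hermite polynomials. *)
Definition heat_kernel1 x : R := - (k * x) * G x.
Definition heat_kernel2 x : R := ((k * x) ^+ 2 - k) * G x.
Definition heat_kernel3 x : R := (3 * k * (k * x) - (k * x) ^+ 3) * G x.

Let sn0 : s != 0. Proof. by rewrite gt_eqF. Qed.

Lemma is_derive_heat_kernel1 (x : R) : is_derive x 1 G (heat_kernel1 x).
Proof.
apply: (is_derive_eq (is_derive_heat_kernel x s0)).
by rewrite /heat_kernel1 /G /k; field.
Qed.

Let dk (x : R) : is_derive x 1 (fun t => k * t) k.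
Proof.
apply: (is_derive_eq (derive_mul_rule (derive_cst_rule k x) (derive_id_rule x))).
by ring.
Qed.

Lemma is_derive_heat_kernel2 (x : R) :
  is_derive x 1 heat_kernel1 (heat_kernel2 x).
Proof.
apply: (is_derive_eq (derive_mul_rule (derive_opp_rule (dk x))
  (is_derive_heat_kernel1 x))).
by rewrite /heat_kernel2 /heat_kernel1; ring.
Qed.

Lemma is_derive_heat_kernel3 (x : R) :
  is_derive x 1 heat_kernel2 (heat_kernel3 x).
Proof.
apply: (is_derive_eq (derive_mul_rule (derive_add_rule
  (derive_exp_rule 2 (dk x)) (derive_cst_rule (- k) x))
  (is_derive_heat_kernel1 x))).
by rewrite /heat_kernel3 /heat_kernel1 /=; ring.
Qed.

Lemma continuous_heat_kernel3 : continuous heat_kernel3.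
Proof.
move=> x; apply: cvgM; last exact: continuous_heat_kernel.
have ck : {for x, continuous (fun x : R => k * x)}.
  by apply: cvgM; [exact: cvg_cst|exact: cvg_id].
apply: cvgB; first by apply: cvgM; [exact: cvg_cst|exact: ck].
apply: (@continuous_comp _ _ _ (fun x => k * x) (fun y => y ^+ 3)) => //.
exact: exprn_continuous.
Qed.

(** Every polynomial factor is at most a constant times [1 + (k x)^4], so it suffices to bound
    [(1 + (k x)^4) * G x]. *)
Lemma heat_kernel_bounds : exists B : R, forall x,
  [/\ `|G x| <= B, `|heat_kernel1 x| <= B, `|heat_kernel2 x| <= B &
      `|heat_kernel3 x| <= B].
Proof.
pose c := (Num.sqrt (4 * pi * s))^-1.
have c0 : 0 < c by rewrite invr_gt0 sqrtr_gt0 !mulr_gt0// pi_gt0.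
have k0 : 0 < k by rewrite invr_gt0 mulr_gt0.
(* With [t = x^2 / (4 s)] one has [x^4 = 16 s^2 t^2], and [t^2 <= 2 exp t] doubles 16 to 32. *)
pose M := c * (1 + 32 * s ^+ 2 * k ^+ 4).
have G0 x : 0 < G x by exact: heat_kernel_gt0.
have GM x : (1 + (k * x) ^+ 4) * G x <= M.
  pose t := x ^+ 2 / (4 * s).
  have t0 : 0 <= t by rewrite divr_ge0 ?sqr_ge0// mulr_ge0// ltW.
  have et := expR_gt0 t.
  have h1 : 1 <= expR t by rewrite -[leLHS]expR0 ler_expR.
  have h2 : t ^+ 2 <= 2 * expR t.
    have := expR_ge1Dxn 1 t0; rewrite (_ : 2`!%:R = 2 :> R)// => h.
    by move: h; rewrite -ler_pdivrMl// => h; lra.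
  have -> : G x = c * (expR t)^-1.
    by rewrite /G /heat_kernel -expRN /t mulNr.
  have -> : (1 + (k * x) ^+ 4) * (c * (expR t)^-1) =
      c * ((1 + 16 * s ^+ 2 * k ^+ 4 * t ^+ 2) / expR t).
    by rewrite /t /k; field; rewrite sn0 gt_eqF.
  suff : 1 + 16 * s ^+ 2 * k ^+ 4 * t ^+ 2 <= (1 + 32 * s ^+ 2 * k ^+ 4) * expR t.
    by rewrite /M ler_pM2l// ler_pdivrMr.
  have -> : (1 + 32 * s ^+ 2 * k ^+ 4) * expR t =
      expR t + 16 * s ^+ 2 * k ^+ 4 * (2 * expR t) by ring.
  have q0 : 0 <= 16 * s ^+ 2 * k ^+ 4.
    by rewrite mulr_ge0 ?exprn_even_ge0// mulr_ge0 ?sqr_ge0.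
  by apply: lerD => //; exact: ler_wpM2l.
have M0 : 0 <= M.
  by apply: le_trans (GM 0); rewrite mulr_ge0 ?(ltW (G0 _))// addr_ge0// exprn_even_ge0.
(* The factor [2 + 4 * k] majorizes the constants 1, [1 + k] and [1 + 3 * k] of the four cases. *)
exists ((2 + 4 * k) * M) => x.
set y := k * x.
have y4 : 0 <= y ^+ 4 by rewrite exprn_even_ge0.
have bnd (q C : R) : 0 <= C -> `|q| <= C * (1 + y ^+ 4) -> C <= 2 + 4 * k ->
    `|q * G x| <= (2 + 4 * k) * M.
  move=> C0 qC CK; rewrite normrM (gtr0_norm (G0 x)).
  apply: (@le_trans _ _ (C * ((1 + y ^+ 4) * G x))).
    by rewrite mulrA ler_wpM2r// ltW.
  apply: ler_pM => //; last exact: GM.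
  by rewrite mulr_ge0 ?(ltW (G0 x))// addr_ge0.
have ysq : 0 <= (y ^+ 2 - 1) ^+ 2 by exact: sqr_ge0.
have y1 : `|y| <= 1 + y ^+ 4.
  rewrite ler_norml; apply/andP; split; nra.
have y2 : y ^+ 2 <= 1 + y ^+ 4 by nra.
have y3 : `|y ^+ 3| <= 1 + y ^+ 4.
  have -> : y ^+ 3 = y * y ^+ 2 by ring.
  rewrite ler_norml; apply/andP; split.
    have := sqr_ge0 (y ^+ 2 + y); have := sqr_ge0 (y ^+ 2 / 2 + y); nra.
  have := sqr_ge0 (y ^+ 2 - y); nra.
split.
- rewrite -[G x]mul1r; apply: (bnd 1 1) => //; rewrite ?normr1; lra.
- by apply: (bnd (- y) 1) => //; rewrite ?normrN ?mul1r//; lra.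
- apply: (bnd (y ^+ 2 - k) (1 + k)); [lra| |lra].
  rewrite (le_trans (ler_normB _ _))// ger0_norm ?sqr_ge0// (gtr0_norm k0).
  by rewrite mulrDl mul1r lerD// ler_peMr ?(ltW k0)// lerDl.
- apply: (bnd (3 * k * y - y ^+ 3) (1 + 3 * k)); [lra| |lra].
  have k3 : 0 < 3 * k by rewrite mulr_gt0.
  rewrite (le_trans (ler_normB _ _))// normrM (gtr0_norm k3) [leLHS]addrC.
  rewrite [leRHS]mulrDl mul1r; apply: lerD => //.
  by apply: ler_wpM2l => //; exact: ltW.
Qed.

End HeatKernelDerivatives.

Lemma heat_kernel_scale (R : realType) (s x : R) : 0 < s ->
  Num.sqrt s * heat_kernel s (Num.sqrt s * x) = gauss x.
Proof.
move=> s0; have s0' := ltW s0; have pi0 := @pi_gt0 R.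
have q0 : 0 < Num.sqrt (4 * pi * 1 : R) by rewrite sqrtr_gt0 !mulr_gt0.
rewrite /gauss /heat_kernel exprMn sqr_sqrtr//.
rewrite (_ : 4 * pi * s = 4 * pi * 1 * s); last by ring.
rewrite sqrtrM ?mulr_ge0 ?(ltW pi0)//.
rewrite (_ : - (s * x ^+ 2) / (4 * s) = - x ^+ 2 / (4 * 1)); last first.
  by field; rewrite gt_eqF.
by field; rewrite !gt_eqF// sqrtr_gt0.
Qed.

(* Completing the square in [y]. *)
Lemma heat_kernel_mul (R : realType) (a b x y z : R) : 0 < a -> 0 < b ->
  heat_kernel a (x - y) * heat_kernel b (y - z) =
  heat_kernel (a + b) (x - z) *
  heat_kernel (a * b / (a + b)) (y - (a * z + b * x) / (a + b)).
Proof.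
move=> a0 b0; have ab0 : 0 < a + b by rewrite addr_gt0.
have pi0 := @pi_gt0 R.
have c0 : 0 < a * b / (a + b) by rewrite divr_gt0// mulr_gt0.
have mulE (p q e f : R) : p^-1 * expR e * (q^-1 * expR f) = (p * q)^-1 * expR (e + f).
  by rewrite expRD invfM; ring.
have pos (t : R) : 0 < t -> 0 <= 4 * pi * t by move=> t0; rewrite ltW// !mulr_gt0.
rewrite /heat_kernel !mulE -(sqrtrM _ (pos _ a0)) -(sqrtrM _ (pos _ ab0)).
congr ((Num.sqrt _)^-1 * expR _).
  by field; rewrite gt_eqF.
by field; rewrite !gt_eqF.
Qed.

Section Regularization.
Context (R : realType) (u0 : R -> R).
Hypothesis hu0 : prob_density u0.
Local Notation leb := (@lebesgue_measure R).

Let P : probability (measurableTypeR R) R := density_measure hu0.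

(** Convolution with [u0], the argument [x - y] being spelled [x + -1 * y] to fit the affine curves
    of the differentiation lemmas. *)
Let reg (f : R -> R) (x : R) : R := \int[P]_y f (x + -1 * y).

Lemma ge0_integral_mul_density (f : R -> R) : continuous f -> (forall y, 0 <= f y) ->
  (\int[leb]_y (f y * u0 y)%:E = \int[P]_y (f y)%:E)%E.
Proof.
move=> cf f0; rewrite ge0_integral_density//.
by apply/measurable_EFinP; exact: continuous_measurable.
Qed.

Let creflect (f : R -> R) (x : R) : continuous f -> continuous (fun y => f (x - y)).
Proof.
move=> cf y; apply: (@continuous_comp _ _ _ (fun y => x - y) f); last exact: cf.
by apply: cvgB; [exact: cvg_cst|exact: cvg_id].
Qed.

Section FixedTime.
Variable s : R.
Hypothesis s0 : 0 < s.
Let G : R -> R := heat_kernel s.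
Let cG : continuous G. Proof. exact: continuous_heat_kernel. Qed.
Let G0 x : 0 <= G x. Proof. exact/ltW/heat_kernel_gt0. Qed.

Lemma heat_convolution_EFin x :
  (convolution G u0 x)%:E = (\int[P]_y (G (x - y))%:E)%E.
Proof.
have [B GB] := heat_kernel_bounds s0.
have cGx := @creflect G x cG.
have intG : P.-integrable setT (fun y => (G (x - y))%:E).
  apply: (@bounded_integrable _ _ _ P _ B) => [|y]; last by have [] := GB (x - y).
  exact: continuous_measurable.
rewrite /convolution /Rintegral ge0_integral_mul_density// fineK//.
exact: integrable_fin_num intG.
Qed.

Let convE : convolution G u0 = reg G.
Proof.
apply/funext => x; apply: EFin_inj; rewrite heat_convolution_EFin.
have [B GB] := heat_kernel_bounds s0.
have intG : P.-integrable setT (fun y => (G (x + -1 * y))%:E).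
  apply: (@bounded_integrable _ _ _ P _ B) => [|y]; last by have [] := GB (x + -1 * y).
  by apply: measurable_affine_comp; exact: continuous_measurable.
rewrite /reg /Rintegral fineK; last exact: integrable_fin_num intG.
by apply: eq_integral => y _; rewrite mulN1r.
Qed.

(** All derivatives fall on the kernel, and averaging against a probability preserves its bounds; no
    regularity of [u0] enters. *)
Lemma smooth_density_heat_convolution : exists B h1 h2 h3,
  smooth_density B (convolution G u0) h1 h2 h3.
Proof.
have [B GB] := heat_kernel_bounds s0.
exists B, (reg (heat_kernel1 s)), (reg (heat_kernel2 s)), (reg (heat_kernel3 s)).
have d1 := is_derive_heat_kernel1 s0.
have d2 := is_derive_heat_kernel2 s0.
have d3 := is_derive_heat_kernel3 s0.
have c3 := continuous_heat_kernel3 s0.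
have c2 := is_derive_continuous d3.
have c1 := is_derive_continuous d2.
have dreg (f df : R -> R) (x : R) : (forall x : R, is_derive x 1 f (df x)) ->
    continuous df -> (forall x, `|f x| <= B) -> (forall x, `|df x| <= B) ->
    is_derive x 1 (reg f) (reg df x).
  move=> fP cdf fB dfB; apply: is_derive_eq.
    apply: (@is_derive_integral_curve _ P f df (fun x => x) (fun=> -1)
      (fun=> 1) (fun=> 0) B 1 0 (x - 1) (x + 1)) => //.
    - by apply/andP; split; lra.
    - by move=> y _; rewrite normr1.
    - by move=> y _; rewrite normr0.
    - apply: (@bounded_integrable _ _ _ P _ 0) => [|y].
        exact: measurable_funM.
      by rewrite mul0r normr0.
  by apply: eq_Rintegral => z _; rewrite mul0r addr0 mulr1.
have breg (f : R -> R) x : continuous f -> (forall x, `|f x| <= B) -> `|reg f x| <= B.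
  move=> cf fB; apply: Rintegral_bound => //.
  by apply: measurable_affine_comp; exact: continuous_measurable.
have b0 x : `|G x| <= B by have [] := GB x.
have b1 x : `|heat_kernel1 s x| <= B by have [] := GB x.
have b2 x : `|heat_kernel2 s x| <= B by have [] := GB x.
have b3 x : `|heat_kernel3 s x| <= B by have [] := GB x.
have hgt0 x : 0 < reg G x.
  apply: Rintegral_gt0 => [|y]; last exact: heat_kernel_gt0.
  apply: (@bounded_integrable _ _ _ P _ B) => [|y]; last exact: b0.
  by apply: measurable_affine_comp; exact: continuous_measurable.
have dh1 (x : R) : is_derive x 1 (reg G) (reg (heat_kernel1 s) x) by exact: dreg.
rewrite convE; split.
- split.
  + by apply: continuous_measurable; exact: (is_derive_continuous dh1).
  + by move=> x; exact: ltW.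
  + have hE x : (reg G x)%:E = (\int[P]_y (G (x + -1 * y))%:E)%E.
      rewrite -convE heat_convolution_EFin.
      by apply: eq_integral => y _; rewrite mulN1r.
    under eq_integral do rewrite hE.
    rewrite integral_mixture//.
    by have [_ _ ->] := @prob_density_heat_kernel R s s0.
- exact: hgt0.
- exact: dh1.
- by move=> x; exact: dreg.
- by move=> x; exact: dreg.
- apply: (@continuous_integral_curve _ P _ (fun x => x) (fun=> -1) B) => //.
  + by move=> x; exact: cvg_id.
  + by move=> x; exact: cvg_cst.
- by move=> x; exact: breg.
- by move=> x; exact: breg.
- by move=> x; exact: breg.
- by move=> x; exact: breg.
Qed.

Lemma finite_second_moment_heat_kernel : finite_second_moment G.
Proof.
have m2 : finite_second_moment (@gauss R).
  have /integrableP[m] := @gauss_sqr_integrable R; apply: le_lt_trans.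
  rewrite ge0_integral_gauss_prob//; last exact: measurableT_comp.
  apply: ge0_le_integral => //.
  - by move=> x _; rewrite lee_fin mulr_ge0 ?sqr_ge0// ltW// gauss_gt0.
  - apply/measurable_EFinP; apply: measurable_funM; first exact: measurable_funX.
    exact: measurable_gauss.
  - apply: emeasurable_funM; first exact: measurableT_comp.
    by apply/measurable_EFinP; exact: measurable_gauss.
  - by move=> x _; rewrite /= ger0_norm ?sqr_ge0// lee_fin.
pose sg := Num.sqrt s; have sg0 : 0 < sg by rewrite sqrtr_gt0.
rewrite /finite_second_moment (@ge0_integral_affine _ _ sg 0 sg0); last 2 first.
- move=> x; apply: cvgM; last exact: cG.
  exact: exprn_continuous.
- by move=> x; rewrite mulr_ge0 ?sqr_ge0.
have E x : sg * ((sg * x + 0) ^+ 2 * G (sg * x + 0)) = s * (x ^+ 2 * gauss x).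
  rewrite addr0 exprMn sqr_sqrtr ?(ltW s0)// -(heat_kernel_scale x s0).
  by rewrite /sg /G; ring.
under eq_integral do rewrite E EFinM.
rewrite ge0_integralZl//.
- by rewrite lte_mul_pinfty ?lee_fin ?(ltW s0).
- apply/measurable_EFinP; apply: measurable_funM; first exact: measurable_funX.
  exact: measurable_gauss.
- by move=> x _; rewrite lee_fin mulr_ge0 ?sqr_ge0// ltW// gauss_gt0.
- by rewrite lee_fin ltW.
Qed.

(** The mixture lemma with exchanged roles: the kernel is the continuous density, [u0] the mixing
    law, and [s = -1]. *)
Lemma finite_second_moment_heat_convolution :
  finite_second_moment u0 -> finite_second_moment (convolution G u0).
Proof.
move=> M2; rewrite /finite_second_moment.
have m2 : P.-integrable setT (fun z : R => (z ^+ 2)%:E).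
  have mX : measurable_fun setT (fun z : R => (z ^+ 2)%:E).
    by apply/measurable_EFinP; exact: measurable_funX.
  apply/integrableP; split => //.
  under eq_integral do rewrite gee0_abs ?lee_fin ?sqr_ge0//.
  by rewrite ge0_integral_density// => x; rewrite lee_fin sqr_ge0.
have := second_moment_mixture (P := P) (-1) (prob_density_heat_kernel s0) cG
  finite_second_moment_heat_kernel m2.
apply: le_lt_trans; rewrite le_eqVlt; apply/orP; left; apply/eqP.
apply: eq_integral => x _; rewrite EFinM heat_convolution_EFin.
by congr (_ * _)%E; apply: eq_integral => y _; rewrite mulN1r.
Qed.

End FixedTime.

(** Tonelli for nonnegative functions, then [heat_kernel_mul]: one Gaussian factor does not depend
    on the middle variable and the other integrates to one. *)
Lemma heat_convolution_semigroup a b : 0 < a -> 0 < b ->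
  convolution (heat_kernel a) (convolution (heat_kernel b) u0) =
  convolution (heat_kernel (a + b)) u0.
Proof.
move=> a0 b0; apply/funext => x.
have ab0 : 0 < a + b by rewrite addr_gt0.
have c0 : 0 < a * b / (a + b) by rewrite divr_gt0// mulr_gt0.
have cH (s : R) : 0 < s -> continuous (@heat_kernel R s) by exact: continuous_heat_kernel.
rewrite {1}/convolution /Rintegral; apply: EFin_inj.
suff E : (\int[leb]_y (heat_kernel a (x - y) * convolution (heat_kernel b) u0 y)%:E =
    (convolution (heat_kernel (a + b)) u0 x)%:E)%E by rewrite E.
under eq_integral => y _.
  rewrite EFinM heat_convolution_EFin// -ge0_integralZl//; last 3 first.
  - apply/measurable_EFinP; apply: continuous_measurable; apply: creflect.
    exact: cH.
  - by move=> z _; rewrite lee_fin ltW// heat_kernel_gt0.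
  - by rewrite lee_fin ltW// heat_kernel_gt0.
  over.
pose f (p : R * R) := ((heat_kernel a (x - p.1))%:E * (heat_kernel b (p.1 - p.2))%:E)%E.
have f0 p : (0 <= f p)%E by rewrite mule_ge0 ?lee_fin ?ltW ?heat_kernel_gt0.
have mf : measurable_fun setT f.
  have mH (s : R) : 0 < s -> measurable_fun setT (@heat_kernel R s).
    by move=> s0; apply: continuous_measurable; exact: cH.
  apply: emeasurable_funM; apply/measurable_EFinP; apply: measurableT_comp.
  - exact: mH.
  - by apply: measurable_funB => //; exact: measurable_fst.
  - exact: mH.
  - by apply: measurable_funB; [exact: measurable_fst|exact: measurable_snd].
have -> := @fubini_tonelli _ _ (measurableTypeR R) (measurableTypeR R) R
  leb P f mf f0.
rewrite heat_convolution_EFin//; apply: eq_integral => z _.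
rewrite /f /=; under eq_integral do rewrite -EFinM heat_kernel_mul// EFinM.
rewrite ge0_integralZl//; last 3 first.
- apply/measurable_EFinP; apply: continuous_measurable => y.
  apply: (@continuous_comp _ _ _ (fun y => y - (a * z + b * x) / (a + b))).
    by apply: cvgB; [exact: cvg_id|exact: cvg_cst].
  exact: cH.
- by move=> y _; rewrite lee_fin ltW// heat_kernel_gt0.
- by rewrite lee_fin ltW// heat_kernel_gt0.
rewrite (@ge0_integral_shift _ (heat_kernel (a * b / (a + b)))
  (- ((a * z + b * x) / (a + b)))); last 2 first.
- exact: cH.
- by move=> y; rewrite ltW// heat_kernel_gt0.
by have [_ _ ->] := prob_density_heat_kernel c0; rewrite mule1.
Qed.

End Regularization.

(** Substitute [y = x + sqrt s * z]; the Jacobian turns the kernel at time [s] into [gauss]. *)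
Lemma heat_convolution_smear (R : realType) (B : R) (w : R -> R) (s x : R) :
  continuous w -> (forall x, `|w x| <= B) -> (forall x, 0 <= w x) -> 0 < s ->
  convolution (heat_kernel s) w x = smear w (Num.sqrt s) x.
Proof.
move=> cw wB w0 s0; have sg0 : 0 < Num.sqrt s by rewrite sqrtr_gt0.
apply: EFin_inj; rewrite (smear_EFin _ _ cw wB).
have E : (\int[@lebesgue_measure R]_y (heat_kernel s (x - y) * w y)%:E =
    \int[gauss_prob R]_z (w (x + Num.sqrt s * z))%:E)%E.
  rewrite (@ge0_integral_affine _ _ (Num.sqrt s) x sg0); last 2 first.
  - move=> y; apply: cvgM; last exact: cw.
    apply: (@continuous_comp _ _ _ (fun y => x - y)).
      by apply: cvgB; [exact: cvg_cst|exact: cvg_id].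
    exact: continuous_heat_kernel.
  - by move=> y; rewrite mulr_ge0// ltW// heat_kernel_gt0.
  rewrite ge0_integral_gauss_prob; last 2 first.
  - apply/measurable_EFinP; apply: measurable_affine_comp.
    exact: continuous_measurable.
  - by move=> z; rewrite lee_fin.
  apply: eq_integral => z _; rewrite -EFinM; congr EFin.
  rewrite opprD addrCA subrr addr0 heat_kernelN mulrA heat_kernel_scale//.
  by rewrite mulrC [x + _]addrC.
rewrite /convolution /Rintegral E -(smear_EFin _ _ cw wB).
by [].
Qed.

(** * The width of the family of CDTs *)

(** By continuity, exceeding the essential bound at one point means exceeding it on a ball, which
    has positive measure. *)
Lemma Lfun_oo_bounded (R : realType) (f : R -> R) :
  continuous f -> f \in Lfun (@lebesgue_measure R) +oo%E ->
  exists B, forall x, `|f x| <= B.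
Proof.
move=> cf /andP[_]; rewrite inE /= /finite_norm unlock.
have -> : (0 < @lebesgue_measure R setT)%E by rewrite -set_itvNyy lebesgue_measure_itv/= ?ltry.
move=> M.
have [B MB] : exists B : R, (ess_sup (@lebesgue_measure R) (abse \o (EFin \o f)) <= B%:E)%E.
  by move: M; case: (ess_sup _ _) => [b _|//|_]; [exists b|exists 0; rewrite leNye].
exists B => x; rewrite leNgt; apply/negP => fxB.
have /ess_supP[A [mA A0 subA]] := MB.
have cnf : continuous (fun y => `|f y|) by move=> y; apply: cvg_norm; exact: cf.
have [e /= e0 eP] : \forall y \near x, B < `|f y|.
  exact: (cvgr_gt _ (cnf x) _ fxB).
have : (@lebesgue_measure R (ball x e) <= @lebesgue_measure R A)%E.
  rewrite le_measure ?inE//; first exact: measurable_ball.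
  move=> y xy; apply: subA => /=; rewrite lee_fin; apply/negP; rewrite -ltNge.
  exact: eP.
rewrite [leRHS]A0 lebesgue_measure_ball ?(ltW e0)// lee_fin.
by rewrite leNgt mulrn_wgt0.
Qed.

Lemma Lfun2P d (X : measurableType d) (R : realType)
    (mu : {measure set X -> \bar R}) (f : X -> R) :
  measurable_fun setT f -> (\int[mu]_x (f x ^+ 2)%:E < +oo)%E ->
  f \in Lfun mu 2%:E.
Proof.
move=> mf f2; apply/andP; split; first by rewrite inE.
rewrite inE /= /finite_norm Lnorm2E; move: f2.
by case: (integral _ _ _) => [a _|//|_] /=; rewrite ltry.
Qed.

(** * Advection as a translation *)

Section Shift.
Context (R : realType).
Local Notation leb := (@lebesgue_measure R).
Definition translate (a : R) (f : R -> R) (x : R) : R := f (x - a).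

Lemma continuous_translate a f : continuous f -> continuous (translate a f).
Proof.
move=> cf x; apply: (@continuous_comp _ _ _ (fun x => x - a) f); last exact: cf.
by apply: cvgB; [exact: cvg_id|exact: cvg_cst].
Qed.

Lemma is_derive_translate a f df : (forall x : R, is_derive x 1 f (df x)) ->
  forall x : R, is_derive x 1 (translate a f) (translate a df x).
Proof.
move=> fP x; rewrite -[translate a df x]mulr1.
apply: (@derive_comp_rule _ f (fun x => x - a)) => //.
apply: (is_derive_eq (derive_add_rule (derive_id_rule x) (derive_cst_rule (- a) x))).
by rewrite addr0.
Qed.

Lemma prob_density_translate a f : continuous f -> prob_density f ->
  prob_density (translate a f).
Proof.
move=> cf [_ f0 f1]; split.
- by apply: continuous_measurable; exact: continuous_translate.
- by move=> x; exact: f0.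
- by rewrite -f1 -(@ge0_integral_shift _ f (- a)).
Qed.

Lemma smooth_density_translate a B w w1 w2 w3 : smooth_density B w w1 w2 w3 ->
  smooth_density B (translate a w) (translate a w1) (translate a w2) (translate a w3).
Proof.
move=> sw; have c0 := smooth_continuous0 sw.
case: sw => hw w0 d1 d2 d3 c3 b0 b1 b2 b3; split.
- exact: prob_density_translate.
- by move=> x; exact: w0.
- exact: is_derive_translate.
- exact: is_derive_translate.
- exact: is_derive_translate.
- exact: continuous_translate.
- by move=> x; exact: b0.
- by move=> x; exact: b1.
- by move=> x; exact: b2.
- by move=> x; exact: b3.
Qed.

Lemma C_const_translate a B w w1 w2 w3 : smooth_density B w w1 w2 w3 ->
  C_const (translate a w) = C_const w.
Proof.
move=> sw; rewrite (C_constE sw) (C_constE (smooth_density_translate a sw)).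
have fisher f m : continuous f ->
    fisher_moment (translate a w) (translate a f) m = fisher_moment w f m.
  move=> cf; rewrite /fisher_moment -[RHS](@ge0_integral_shift _ _ (- a))//.
  - move=> x; apply: cvgM; last exact: (smooth_continuous0 sw).
    apply: (@continuous_comp _ _ _ (fun x => `|f x / w x|) (fun y => y ^+ m)).
      by apply: cvg_norm; exact: (continuous_div_density sw cf).
    exact: exprn_continuous.
  - by move=> x; rewrite mulr_ge0 ?exprn_ge0// ltW// (smooth_gt0 sw).
rewrite !fisher//; [exact: (smooth_continuous1 sw)|exact: (smooth_continuous2 sw)|
  exact: (smooth_continuous1 sw)|exact: (smooth_continuous3 sw)].
Qed.

(** Translating the density only adds a constant to the CDT. Advection therefore contributes
    [A * t], uniformly in [xi]. *)
Lemma cdt_translate (r v : R -> R) a xi :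
  prob_density r -> (forall x, 0 < r x) ->
  prob_density v -> (forall x, 0 < v x) -> continuous v ->
  cdt r (translate a v) xi = cdt r v xi + a.
Proof.
move=> hr r0 hv v0 cv.
have hs := prob_density_translate a cv hv.
have s0 x : 0 < translate a v x by exact: v0.
have E x : cumulative (translate a v) x = cumulative v (x - a).
  apply: (@eq_distribution_function _ _ (translate a (cumulative v)) (translate a v)).
  - by apply: is_derive_cumulative => //; exact: continuous_translate.
  - by apply: is_derive_translate; exact: is_derive_cumulative.
  - by move=> y; rewrite (cumulative_gt0 hs s0) (cumulative_lt1 hs s0).
  - exact: cumulative_surj.
  - move=> y; rewrite /translate (ltW (cumulative_gt0 hv v0 _)).
    exact: ltW (cumulative_lt1 hv v0 _).
have cE : cumulative (translate a v) (cdt r v xi + a) = cumulative r xi.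
  by rewrite E addrK (cumulative_cdt hr r0 hv v0).
by rewrite {1}/cdt -cE (quantile_cumulative hs s0).
Qed.

End Shift.

(** * The approximating subspace and the width bound *)

Section Width.
Context (R : realType).
Variables (D A t0 T : R) (r : R -> R) (B : R) (w w1 w2 w3 : R -> R) (u : R -> R -> R).
Hypotheses (D0 : 0 < D) (t0T : t0 < T).
Hypotheses (hr : prob_density r) (r_gt0 : forall x, 0 < r x).
Hypothesis sw : smooth_density B w w1 w2 w3.
Hypothesis M2 : finite_second_moment w.
(** The common form of both regimes. The profile [w] is the one at [t0] before translation, which is
    why the shift is [A * t] and not [A * (t - t0)]. *)
Hypothesis uE : forall t, t0 <= t <= T ->
  u t = translate (A * t) (smear w (Num.sqrt (D * (t - t0)))).
Local Notation mu := (density_measure hr).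

Let hw := smooth_prob sw.
Let w_gt0 := smooth_gt0 sw.

Let Lfun_cst (c : R) : (fun=> c) \in Lfun mu 2%:E.
Proof.
apply: Lfun2P => //; rewrite integral_cst//= probability_setT mule1.
exact: ltry.
Qed.

Let Lfun_add (f g : R -> R) : f \in Lfun mu 2%:E -> g \in Lfun mu 2%:E ->
  (fun x => f x + g x) \in Lfun mu 2%:E.
Proof.
have p1 : (1 <= 2%:E :> \bar R)%E by rewrite lee_fin ler1n.
move=> fL gL; have [_ /(_ 1 f g fL gL)] := Lfun_submod_closed mu p1.
by rewrite scale1r.
Qed.

Let Lfun_scale (a : R) (f : R -> R) : f \in Lfun mu 2%:E ->
  (fun x => a * f x) \in Lfun mu 2%:E.
Proof.
have p1 : (1 <= 2%:E :> \bar R)%E by rewrite lee_fin ler1n.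
move=> fL; have [L0 /(_ a f 0 fL L0)] := Lfun_submod_closed mu p1.
by rewrite addr0.
Qed.

(** By transport, the squared [L^2(dr)] norm of a CDT is the second moment of its density. *)
Let Lfun_cdt_smear s : cdt r (smear w s) \in Lfun mu 2%:E.
Proof.
have sws := smooth_density_smear s sw.
have hs := smooth_prob sws; have s_gt0 := smooth_gt0 sws.
apply: Lfun2P; first exact: measurable_cdt s_gt0.
have mX : measurable_fun setT (fun x : R => (x ^+ 2)%:E).
  by apply/measurable_EFinP; exact: measurable_funX.
rewrite (ge0_integral_cdt hr r_gt0 hs s_gt0 mX); last by move=> x; rewrite lee_fin sqr_ge0.
rewrite ge0_integral_density//; last by move=> x; rewrite lee_fin sqr_ge0.
under eq_integral do rewrite -EFinM.
exact: (finite_second_moment_smear hw (smooth_continuous0 sw) (smooth_bound0 sw)).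
Qed.

Let cdt_u t : t0 <= t <= T ->
  cdt r (u t) = (fun xi => cdt r (smear w (Num.sqrt (D * (t - t0)))) xi + A * t).
Proof.
move=> tT; apply/funext => xi; rewrite uE//.
have sws := smooth_density_smear (Num.sqrt (D * (t - t0))) sw.
apply: (cdt_translate _ _ hr r_gt0 (smooth_prob sws) (smooth_gt0 sws)).
exact: (smooth_continuous0 sws).
Qed.

Lemma cdt_solution_L2 : [set cdt r (u t) | t in `[t0, T]] `<=` [set` Lfun mu 2%:E].
Proof.
move=> f [t /=]; rewrite in_itv/= => tT <-.
by rewrite cdt_u//; apply: Lfun_add.
Qed.

Let C_const_u0 : C_const (u t0) = C_const w.
Proof.
rewrite uE ?lexx ?(ltW t0T)// (C_const_translate _ (smooth_density_smear _ sw)).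
rewrite subrr mulr0 sqrtr0; congr C_const.
by apply/funext => x; exact: smear0.
Qed.

Lemma cdt_solution_width :
  (L2_width mu 2 [set cdt r (u t) | t in `[t0, T]]
   <= (D ^+ 2 * ((T - t0) ^+ 2 / 2))%:E * C_const (u t0))%E.
Proof.
rewrite C_const_u0.
have K0 : 0 < D ^+ 2 * ((T - t0) ^+ 2 / 2).
  by rewrite mulr_gt0 ?divr_gt0 ?exprn_gt0// subr_gt0.
have [Cy|Cfin] := eqVneq (C_const w) +oo%E.
  by rewrite Cy gt0_muley ?lte_fin// leey.
have [c Cc] : exists c, C_const w = c%:E.
  have : (0 <= C_const w)%E by exact: sqrte_ge0.
  by move: Cfin; case: (C_const w) => [c|//|//]; exists c.
have c0 : 0 <= c by rewrite -lee_fin -Cc; exact: sqrte_ge0.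
pose X xi := cdt r w xi; pose V xi := w1 (X xi) / w (X xi).
have XL : X \in Lfun mu 2%:E.
  have := Lfun_cdt_smear 0; rewrite (_ : smear w 0 = w)//.
  by apply/funext => x; exact: smear0.
have mscore : measurable_fun setT (fun x => w1 x / w x).
  apply: continuous_measurable; apply: (continuous_div_density sw).
  exact: (smooth_continuous1 sw).
have VL : V \in Lfun mu 2%:E.
  apply: Lfun2P.
    by apply: (measurableT_comp mscore); exact: measurable_cdt w_gt0.
  rewrite (@ge0_integral_cdt _ r w hr r_gt0 hw w_gt0 (fun x => ((w1 x / w x) ^+ 2)%:E)).
  - by apply: fisher_information_lty; rewrite Cc ltry.
  - by apply/measurable_EFinP; exact: measurable_funX.
  - by move=> x; rewrite lee_fin sqr_ge0.
(* The CDT at [t0] and its time derivative there: [A] from advection, [- D * V] from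
   [dZ / dtau = - w1 / w] with [tau = D (t - t0)]. *)
pose b (i : 'I_2) : R -> R :=
  if i == 0 then (fun xi => X xi + A * t0) else (fun xi => A + - D * V xi).
have b0E xi : b 0 xi = X xi + A * t0 by [].
have b1E xi : b 1 xi = A + - D * V xi by [].
have bL i : b i \in Lfun mu 2%:E.
  rewrite /b; case: ifP => _; apply: Lfun_add => //.
  exact: Lfun_scale.
pose E2 : set (R -> R) := range (fun c : 'I_2 -> R => \sum_(i < 2) c i *: b i).
have E2E (a : 'I_2 -> R) xi :
    (\sum_(i < 2) a i *: b i) xi = a 0 * b 0 xi + a 1 * b 1 xi.
  rewrite big_ord_recl big_ord1.
  by have -> : lift ord0 ord0 = 1 :> 'I_2 by exact: val_inj.
apply: (@le_trans _ _ (ereal_sup [set ereal_inf [set Lnorm mu 2%:E (EFin \o (f - h)) | h in E2]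
    | f in [set cdt r (u t) | t in `[t0, T]]])).
  apply: ereal_inf_lbound; exists E2 => //; split; last by exists b.
  move=> _ [a _ <-] /=.
  rewrite (_ : \sum_(i < 2) _ = fun xi => a 0 * b 0 xi + a 1 * b 1 xi).
    by apply: Lfun_add; exact: Lfun_scale.
  by apply/funext => xi; exact: E2E.
apply: ge_ereal_sup => y [f [t /=]]; rewrite in_itv/= => tT <- <-.
have /andP[t0t tT'] := tT.
pose S := Num.sqrt (D * (t - t0)).
have S2 : S ^+ 2 = D * (t - t0).
  by rewrite sqr_sqrtr// mulr_ge0 ?(ltW D0)// subr_ge0.
(* The Taylor polynomial at [t0]: the translations cancel in [cdt r (u t) - h], leaving exactly
   [taylor_remainder]. *)
pose h : R -> R := fun xi => 1 * b 0 xi + (t - t0) * b 1 xi.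
apply: (@le_trans _ _ (Lnorm mu 2%:E (EFin \o (cdt r (u t) - h)))).
  apply: ereal_inf_lbound; exists h => //.
  exists (fun i : 'I_2 => if i == 0 then 1 else t - t0) => //.
  by apply/funext => xi; rewrite E2E.
have -> : cdt r (u t) - h = taylor_remainder r w w1 S.
  apply/funext => xi; rewrite cdt_u// /taylor_remainder S2 -/S.
  transitivity (cdt r (smear w S) xi + A * t - h xi); first by [].
  rewrite /h b0E b1E /V /X; ring.
apply: le_trans (L2_taylor_remainder_le hr r_gt0 sw (sqrtr_ge0 _) Cc) _.
rewrite Cc -EFinM lee_fin ler_wpM2r//.
have -> : S ^+ 4 = (S ^+ 2) ^+ 2 by rewrite -exprM.
rewrite S2 exprMn -mulrA ler_wpM2l ?sqr_ge0//.
rewrite ler_wpM2r ?invr_ge0// lerXn2r ?nnegrE ?subr_ge0 ?(ltW t0T)//.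
by rewrite lerD2r.
Qed.

End Width.

Lemma C3_smooth_density (R : realType) (w : R -> R) :
  prob_density w -> C3 w -> (forall x, 0 < w x) ->
  (forall j, (j <= 3)%N -> derive1n j w \in Lfun (@lebesgue_measure R) +oo%E) ->
  exists B, smooth_density B w (derive1n 1 w) (derive1n 2 w) (derive1n 3 w).
Proof.
move=> hw [dw c3] w0 Lw.
have d j (x : R) : (j < 3)%N -> is_derive x 1 (derive1n j w) (derive1n j.+1 w x).
  by move=> j3; apply: DeriveDef; [exact: dw|rewrite -derive1E].
have c j : (j <= 3)%N -> continuous (derive1n j w).
  rewrite leq_eqVlt => /predU1P[->//|j3].
  by apply: is_derive_continuous => x; exact: d.
have bounded j : (j <= 3)%N -> exists B, forall x, `|derive1n j w x| <= B.
  by move=> j3; apply: Lfun_oo_bounded; [exact: c|exact: Lw].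
have [B0 b0] := bounded 0%N isT; have [B1 b1] := bounded 1%N isT.
have [B2 b2] := bounded 2%N isT; have [B3 b3] := bounded 3%N isT.
exists (Num.max (Num.max B0 B1) (Num.max B2 B3)); split.
- exact: hw.
- exact: w0.
- by move=> x; exact: (d 0%N).
- by move=> x; exact: (d 1%N).
- by move=> x; exact: (d 2%N).
- exact: c3.
- by move=> x; rewrite !le_max b0.
- by move=> x; rewrite !le_max b1 ?orbT.
- by move=> x; rewrite !le_max b2 ?orbT.
- by move=> x; rewrite !le_max b3 ?orbT.
Qed.

Section AdvectionDiffusionEvolution.
Context (R : realType).
Variables (D A : R) (u0 : R -> R).
Hypotheses (D0 : 0 < D) (hu0 : prob_density u0).

Lemma advdiff_solution_from_pos t0 t : 0 < t0 -> t0 <= t ->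
  advdiff_solution D A u0 t =
  translate (A * t) (smear (convolution (heat_kernel (D * t0)) u0)
    (Num.sqrt (D * (t - t0)))).
Proof.
move=> t00 t0t; have t_gt0 := lt_le_trans t00 t0t.
have Dt0 : 0 < D * t0 by rewrite mulr_gt0.
have [B [h1 [h2 [h3 sw]]]] := smooth_density_heat_convolution hu0 Dt0.
rewrite /advdiff_solution t_gt0; apply/funext => x; rewrite /translate.
(* At [t = t0] the elapsed time is zero, where the semigroup property does not apply but [smear] is
   the identity. *)
move: t0t; rewrite le_eqVlt => /predU1P[->|lt0t].
  by rewrite subrr mulr0 sqrtr0 smear0.
have Ddt : 0 < D * (t - t0) by rewrite mulr_gt0 ?subr_gt0.
rewrite -(heat_convolution_smear _ (smooth_continuous0 sw) (smooth_bound0 sw))//.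
  rewrite (heat_convolution_semigroup hu0)// -mulrDr subrK//.
by move=> y; exact/ltW/(smooth_gt0 sw).
Qed.

Lemma advdiff_solution_from0 B w1 w2 w3 t : smooth_density B u0 w1 w2 w3 -> 0 <= t ->
  advdiff_solution D A u0 t =
  translate (A * t) (smear u0 (Num.sqrt (D * (t - 0)))).
Proof.
move=> sw t0; apply/funext => x; rewrite /advdiff_solution /translate subr0.
move: t0; rewrite le_eqVlt => /predU1P[<-|t_gt0].
  by rewrite ltxx !mulr0 sqrtr0 smear0 subr0.
rewrite t_gt0.
apply: (heat_convolution_smear _ (smooth_continuous0 sw) (smooth_bound0 sw)).
- by move=> y; exact/ltW/(smooth_gt0 sw).
- by rewrite mulr_gt0.
Qed.

End AdvectionDiffusionEvolution.

Theorem theorem5p6 (R : realType) (D A T : R) (u0 r : R -> R)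
    (hD : 0 < D) (hT : 0 < T)
    (hu0 : prob_density u0) (hu0_moment : finite_second_moment u0)
    (hr : prob_density r) (hr_pos : forall x, 0 < r x) :
  let u := advdiff_solution D A u0 in
  let M (t0 : R) : set (R -> R) := [set cdt r (u t) | t in `[t0, T]] in
  let L2dr : set (R -> R) := [set` Lfun (density_measure hr) 2%:E] in
  let bound (t0 : R) : Prop :=
    M t0 `<=` L2dr /\
    (L2_width (density_measure hr) 2 (M t0)
       <= (D ^+ 2 * ((T - t0) ^+ 2 / 2))%:E * C_const (u t0))%E in
  (forall t0 : R, 0 < t0 < T -> bound t0)
  /\ (C3 u0 ->
      (forall x, 0 < u0 x) ->
      (forall j, (j <= 3)%N ->
         derive1n j u0 \in Lfun lebesgue_measure +oo%E /\
         derive1n j u0 \in Lfun lebesgue_measure 1%E) ->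
      bound 0).
Proof.
move=> u M L2dr bound; split.
- move=> t0 /andP[t00 t0T].
  have Dt0 : 0 < D * t0 by rewrite mulr_gt0.
  have [B [h1 [h2 [h3 sw]]]] := smooth_density_heat_convolution hu0 Dt0.
  have M2 := finite_second_moment_heat_convolution hu0 Dt0 hu0_moment.
  have uE t : t0 <= t <= T -> u t = translate (A * t)
      (smear (convolution (heat_kernel (D * t0)) u0) (Num.sqrt (D * (t - t0)))).
    by move=> /andP[t0t _]; exact: advdiff_solution_from_pos.
  by split; [exact: (cdt_solution_L2 hr hr_pos sw M2 uE)|
    exact: (cdt_solution_width hD t0T hr hr_pos sw M2 uE)].
- move=> u0C3 u0_gt0 Lu0.
  have [B sw] := C3_smooth_density hu0 u0C3 u0_gt0 (fun j j3 => (Lu0 j j3).1).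
  have uE t : 0 <= t <= T ->
      u t = translate (A * t) (smear u0 (Num.sqrt (D * (t - 0)))).
    by move=> /andP[t0 _]; exact: advdiff_solution_from0 sw t0.
  by split; [exact: (cdt_solution_L2 hr hr_pos sw hu0_moment uE)|
    exact: (cdt_solution_width hD hT hr hr_pos sw hu0_moment uE)].
Qed.
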